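(* There is a constant $C_n>0$ depending only on $n$ such that the following holds. Let $T:L^\infty_c(\mathbf{R}^d;\mathbf{F}^n)\to L^0(\mathbf{R}^d;\mathbf{F}^n)$ be an operator for which there is a constant $C_T>0$ such that for every $f\in L^\infty_c(\mathbf{R}^d;\mathbf{F}^n)$ there is a sparse collection $\mathcal{S}$ for which $$Tf(x)\in C_T\sum_{Q\in\mathcal{S}}\langle\!\langle f\rangle\!\rangle_Q\mathbf{1}_Q(x)$$ for a.e. $x\in\mathbf{R}^d$. Let $\mathbf{X}$ be a Köthe reflexive $\mathbf{F}^n$-directional Banach function space over $\mathbf{R}^d$ for which $$M^{\mathcal{K}}:\mathbf{X}[\mathcal{K}]\to \mathbf{X}[\mathcal{K}],\qquad M^{\mathcal{K}}:\mathbf{X}'[\mathcal{K}]\to \mathbf{X}'[\mathcal{K}].$$ Then, for all $f\in L^\infty_c(\mathbf{R}^d;\mathbf{F}^n)\cap\mathbf{X}$ we have $$\|Tf\|_{\mathbf{X}}\le C_n\, C_T\|M^{\mathcal{K}}\|_{\mathbf{X}[\mathcal{K}]\to\mathbf{X}[\mathcal{K}]}\|M^{\mathcal{K}}\|_{\mathbf{X}'[\mathcal{K}]\to\mathbf{X}'[\mathcal{K}]}\|f\|_{\mathbf{X}}.$$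
   Context: **Basic notation.** $d,n\ge 1$ are fixed integers, $\mathbf{F}$ is $\mathbf{R}$ or $\mathbf{C}$, $u\cdot v=\sum_{k=1}^n u_k\overline{v_k}$ on $\mathbf{F}^n$. $L^0(\mathbf{R}^d;\mathbf{F}^n)$ is the space of measurable functions $\mathbf{R}^d\to\mathbf{F}^n$ (modulo a.e. equality; Lebesgue measure), and $L^\infty_c(\mathbf{R}^d;\mathbf{F}^n)$ the subspace of bounded functions with bounded support. A cube is a cube in $\mathbf{R}^d$ with sides parallel to the coordinate axes. For $f$ integrable over $Q$, $\langle\!\langle f\rangle\!\rangle_Q:=\{\frac1{|Q|}\int_Qhf\,dx:h\in L^\infty(\mathbf{R}^d),\ \|h\|_{L^\infty(\mathbf{R}^d)}\le1\}$. **Convex-set valued maps.** $\mathcal{K}$ is the collection of non-empty closed convex $K\subseteq\mathbf{F}^n$ that are symmetric: $\lambda u\in K$ for $u\in K$, $\lambda\in\mathbf{F}$, $|\lambda|=1$. For $u\in\mathbf{F}^n$, $\mathcal{K}(u)=\{\lambda u:\lambda\in\mathbf{F},|\lambda|\le1\}$, and for a function $f$, $\mathcal{K}(f)(x):=\mathcal{K}(f(x))$. Finite sums of sets are closed Minkowski sums $K+L=\overline{\{u+v:u\in K,v\in L\}}$; an infinite sum of sets in $\mathcal K$ is the closure of the union of all finite partial sums. $L^0(\mathbf{R}^d;\mathcal{K})$ is the set of $F:\mathbf{R}^d\to\mathcal{K}$ such that $\{x:F(x)\cap E\ne\emptyset\}$ is measurable for every measurable (equivalently, every open) $E\subseteq\mathbf{F}^n$.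 $S^0(\mathbf{R}^d;F)$ is the set of $f\in L^0(\mathbf{R}^d;\mathbf{F}^n)$ with $f(x)\in F(x)$ a.e. **Directional Banach function spaces.** An $\mathbf{F}^n$-directional Banach function space $\mathbf{X}$ over $\mathbf{R}^d$ is a complete normed subspace of $L^0(\mathbf{R}^d;\mathbf{F}^n)$ with: (directional ideal property) if $f\in\mathbf{X}$, $g\in L^0(\mathbf{R}^d;\mathbf{F}^n)$ and $\mathcal{K}(g)(x)\subseteq\mathcal{K}(f)(x)$ a.e., then $g\in\mathbf{X}$ and $\|g\|_{\mathbf{X}}\le\|f\|_{\mathbf{X}}$; (non-degeneracy) if $g\in L^0(\mathbf{R}^d;\mathbf{F}^n)$ and $\int f\cdot g\,dx=0$ for all $f\in\mathbf{X}$, then $g=0$ a.e. Its Köthe dual $\mathbf{X}'$ consists of the $g\in L^0(\mathbf{R}^d;\mathbf{F}^n)$ with $\|g\|_{\mathbf{X}'}:=\sup_{\|f\|_{\mathbf{X}}=1}\int|f\cdot g|\,dx<\infty$; $\mathbf{X}$ is Köthe reflexive if $\mathbf{X}''=\mathbf{X}$ with equal norm. $\mathbf{X}[\mathcal{K}]$ is the set of $F\in L^0(\mathbf{R}^d;\mathcal{K})$ for which $S^0(\mathbf{R}^d;F)$ is a bounded subset of $\mathbf{X}$, with $\|F\|_{\mathbf{X}[\mathcal{K}]}:=\sup_{f\in S^0(\mathbf{R}^d;F)}\|f\|_{\mathbf{X}}$. **Maximal operator.** $L^1_{\mathrm{loc}}(\mathbf{R}^d;\mathcal{K})$ is the set of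 $F\in L^0(\mathbf{R}^d;\mathcal{K})$ such that for each cube $Q$ the set $S^0(\mathbf{R}^d;F\mathbf{1}_Q)$ is bounded in $L^1(\mathbf{R}^d;\mathbf{F}^n)$, where $F\mathbf{1}_Q$ equals $F$ on $Q$ and $\{0\}$ off $Q$. For such $F$, $\langle F\rangle_Q:=\{\frac1{|Q|}\int_Qf\,dx:f\in S^0(\mathbf{R}^d;F\mathbf{1}_Q)\}$, and $M^{\mathcal{K}}F(x)$ is the smallest set in $\mathcal{K}$ containing $\bigcup_{Q\ni x}\langle F\rangle_Q$ (all cubes $Q$ containing $x$). $M^{\mathcal{K}}:\mathbf{X}[\mathcal{K}]\to\mathbf{X}[\mathcal{K}]$ means that $\mathbf{X}[\mathcal{K}]\subseteq L^1_{\mathrm{loc}}(\mathbf{R}^d;\mathcal{K})$ and $\|M^{\mathcal{K}}F\|_{\mathbf{X}[\mathcal{K}]}\le C\|F\|_{\mathbf{X}[\mathcal{K}]}$ for all $F$ with some $C<\infty$; the smallest $C$ is $\|M^{\mathcal{K}}\|_{\mathbf{X}[\mathcal{K}]\to\mathbf{X}[\mathcal{K}]}$. Similarly for $\mathbf{X}'$. **Sparse collections.** A collection of cubes $\mathcal{S}$ is called sparse if for all $Q\in\mathcal{S}$, $\big|\bigcup_{Q'\in\mathcal{S},\,Q'\subsetneq Q}Q'\big|\le\frac12|Q|$.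
   Formalization: Sparse collections are also required to have pairwise disjoint (up to null sets) parts Q minus the union of the smaller cubes, automatic in a dyadic grid; without it T = N·Id on L^2(R), dominated via equal-length intervals with rational endpoints, refutes the claim. *)

(* Defs.v *)
From HB Require Import structures.
From mathcomp Require Import all_boot all_order all_algebra.
From mathcomp Require Import all_classical all_reals all_analysis.
From mathcomp.real_closed Require Import complex.

Set Implicit Arguments.
Unset Strict Implicit.
Unset Printing Implicit Defensive.

Import Order.TTheory GRing.Theory Num.Theory.
Import numFieldNormedType.Exports.

Local Open Scope classical_set_scope.
Local Open Scope ring_scope.

Section lebesgue_Rd.
Context (R : realType).
Local Notation RR := (measurableTypeR R).

Definition cons_pair d (p : RR * d.-tuple RR) : d.+1.-tuple RR :=
  [the d.+1.-tuple RR of p.1 :: p.2].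

Definition uncons d (t : d.+1.-tuple RR) : RR * d.-tuple RR :=
  (thead t, [tuple of behead t]).

Lemma cons_pairK d : cancel (@cons_pair d) (@uncons d).
Proof.
by move=> [x t]; rewrite /uncons /cons_pair /= theadE; congr pair; exact: val_inj.
Qed.


Lemma measurable_cons_pair d : measurable_fun [set: RR * d.-tuple RR] (@cons_pair d).
Proof. by apply: measurable_cons. Qed.

Lemma measurable_uncons d : measurable_fun [set: d.+1.-tuple RR] (@uncons d).
Proof.
apply/measurable_fun_pairP; split; first exact: (measurable_tnth ord0).
exact: measurable_behead.
Qed.

Section step.
Context d (mu : {sigma_finite_measure set (d.-tuple RR) -> \bar R}).

Definition leb_step : set (d.+1.-tuple RR) -> \bar R :=
  pushforward (@lebesgue_measure R \x mu)%E (@cons_pair d).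

Let mcons := @measurable_cons_pair d.

Let leb_step0 : leb_step set0 = 0%E. Proof. exact: (measure0 (pushforward _ _)). Qed.

Let leb_step_ge0 A : (0 <= leb_step A)%E. Proof. exact: (measure_ge0 (pushforward _ _)). Qed.

Let leb_step_sigma_additive : semi_sigma_additive leb_step.
Proof. exact: (@measure_semi_sigma_additive _ _ _ (pushforward _ _)). Qed.

HB.instance Definition _ := isMeasure.Build _ _ _ leb_step
  leb_step0 leb_step_ge0 leb_step_sigma_additive.

Let leb_step_sigma_finite : sigma_finite setT leb_step.
Proof.
have /sigma_finiteP[F [TF ndF Foo]] :=
  sigma_finiteT (@lebesgue_measure R : {sigma_finite_measure set RR -> \bar R}).
have /sigma_finiteP[G [TG ndG Goo]] := sigma_finiteT mu.
exists (fun i => @uncons d @^-1` (F i `*` G i)).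
  apply/esym; rewrite -subTset => t _.
  have [n _ Fn] : (\bigcup_i F i) (uncons t).1 by rewrite -TF.
  have [m _ Gm] : (\bigcup_i G i) (uncons t).2 by rewrite -TG.
  exists (maxn n m) => //; split.
  - by move: Fn; exact/subsetPset/ndF/leq_maxl.
  - by move: Gm; exact/subsetPset/ndG/leq_maxr.
move=> i; have [mF Fi] := Foo i; have [mG Gi] := Goo i; split.
  by rewrite -[X in measurable X]setTI; apply: measurable_uncons => //;
    exact: measurableX.
rewrite /leb_step /pushforward.
have -> : @cons_pair d @^-1` (@uncons d @^-1` (F i `*` G i)) = F i `*` G i.
  by apply/funext => p; rewrite /preimage /mkset cons_pairK.
by rewrite product_measure1E// lte_mul_pinfty// ge0_fin_numE.
Qed.

HB.instance Definition _ := Measure_isSigmaFinite.Build _ _ _ leb_step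
  leb_step_sigma_finite.
End step.

Fixpoint borel_leb (d : nat) : {sigma_finite_measure set (d.-tuple RR) -> \bar R} :=
  if d is d'.+1 then leb_step (borel_leb d') else \d_([tuple] : 0.-tuple RR).

(* Caratheodory completion of the Borel measure: the measurable sets of [Rd d]
   are exactly the Lebesgue measurable ones. *)
Definition Rd (d : nat) : measurableType _ :=
  caratheodory_type ((borel_leb d)^*)%mu.

Definition leb (d : nat) : {measure set (Rd d) -> \bar R} :=
  @completed_measure_extension _ (d.-tuple RR) R (borel_leb d).

Definition coord d (x : Rd d) (i : 'I_d) : R := tnth (x : d.-tuple RR) i.

(* Open, closed and half-open cubes are all allowed, according to the values of
   [bl] and [br]. *)
Definition cube d (Q : set (Rd d)) : Prop :=
  exists (a : d.-tuple R) (l : R) (bl br : bool), 0 < l /\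
    Q = [set x | forall i,
      coord x i \in Interval (BSide bl (tnth a i)) (BSide br (tnth a i + l))].

End lebesgue_Rd.

Inductive scalar_field := RealScalar | ComplexScalar.

Section scalars.
Context (R : realType).

Definition scalarF (k : scalar_field) : numFieldType :=
  match k with RealScalar => R | ComplexScalar => R[i] end.

Definition sRe (k : scalar_field) : scalarF k -> R :=
  match k with RealScalar => id | ComplexScalar => @complex.Re R end.

Definition sIm (k : scalar_field) : scalarF k -> R :=
  match k with RealScalar => fun=> 0 | ComplexScalar => @complex.Im R end.

(* [sC a b] is a + i b; b is ignored when F = R. *)
Definition sC (k : scalar_field) : R -> R -> scalarF k :=
  match k with RealScalar => fun a _ => a | ComplexScalar => @Complex R end.

Definition sconj (k : scalar_field) : scalarF k -> scalarF k :=
  match k with RealScalar => id | ComplexScalar => @conjc R end.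

(* In MathComp the modulus [`|z|] lives in F; it is real. *)
Definition sabs (k : scalar_field) (z : scalarF k) : R := sRe `|z|.

End scalars.

Section vectors.
Context (R : realType) (k : scalar_field) (n : nat).
Local Notation F := (scalarF R k).
Local Notation V := 'rV[F]_n.

Definition dot (u v : V) : F := \sum_(j < n) u 0 j * sconj (v 0 j).

Definition vnorm (u : V) : R := Num.sqrt (\sum_(j < n) sabs (u 0 j) ^+ 2).

Definition rscale (c : R) (u : V) : V := sC k c 0 *: u.

Definition convex_body (K : set V) : Prop :=
  [/\ K !=set0, closed K, convex_set (K : set (convex_lmodType V)) &
      forall (l : F) u, `|l| = 1 -> K u -> K (l *: u)].

Definition Kvec (u : V) : set V := [set l *: u | l in [set l : F | `|l| <= 1]].

Definition convex_hullK (U : set V) : set V :=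
  [set u | forall K, convex_body K -> U `<=` K -> K u].

Definition minkowski (K L : set V) : set V :=
  closure [set w | exists u v, [/\ K u, L v & w = u + v]].

(* Closure of the union of the partial sums over the finite subsets of [S], which
   are enumerated without repetition by [s]. *)
Definition setsum (I : eqType) (S : set I) (A : I -> set V) : set V :=
  closure (\bigcup_(s in [set s : seq I | uniq s /\ forall i, i \in s -> S i])
             \big[minkowski/[set 0]]_(i <- s) A i).

End vectors.

Section functions.
Context (R : realType) (k : scalar_field) (d n : nat).
Local Notation F := (scalarF R k).
Local Notation V := 'rV[F]_n.
Local Notation Rd := (Rd R d).
Local Notation mu := (leb R d).

Definition borel_fun (W : ptopologicalType) (f : Rd -> W) : Prop :=
  measurable_fun setT (f : Rd -> g_sigma_algebraType (@open W)).

Definition ae_eq_fun (W : Type) (f g : Rd -> W) : Prop :=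
  {ae mu, forall x, f x = g x}.

(* L^0 and its subspaces are represented by sets of genuine functions that are
   stable under a.e. equality. *)
Definition L0 (f : Rd -> V) : Prop := borel_fun f.

Definition Linfc (f : Rd -> V) : Prop :=
  [/\ L0 f,
      exists M : R, {ae mu, forall x, vnorm (f x) <= M} &
      exists r : R, {ae mu, forall x, (exists i, r < `|coord x i|) -> f x = 0}].

Definition sintegrable (h : Rd -> F) : Prop :=
  mu.-integrable setT (fun x => (sRe (h x))%:E) /\
  mu.-integrable setT (fun x => (sIm (h x))%:E).

Definition sintegral (D : set Rd) (h : Rd -> F) : F :=
  sC k (Rintegral mu D (fun x => sRe (h x))) (Rintegral mu D (fun x => sIm (h x))).

Definition vavg (Q : set Rd) (f : Rd -> V) : V :=
  rscale (fine (mu Q))^-1 (\row_j sintegral Q (fun x => f x 0 j)).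

(* The multipliers h take values in F, so that [cavg f Q] is symmetric over F. *)
Definition cavg (f : Rd -> V) (Q : set Rd) : set V :=
  [set vavg Q (fun x => h x *: f x) | h in
    [set h : Rd -> F | borel_fun h /\ {ae mu, forall x, `|h x| <= 1}]].

(* Measurability of set-valued maps is tested on open sets; since [leb] is
   complete, this amounts to testing it on all Borel sets. *)
Definition L0K (G : Rd -> set V) : Prop :=
  (forall x, convex_body (G x)) /\
  (forall E : set V, open E -> measurable [set x | G x `&` E !=set0]).

Definition S0 (G : Rd -> set V) : set (Rd -> V) :=
  [set f | L0 f /\ {ae mu, forall x, G x (f x)}].

Definition Krestrict (Q : set Rd) (G : Rd -> set V) (x : Rd) : set V :=
  if `[< Q x >] then G x else [set 0].

Definition L1locK (G : Rd -> set V) : Prop :=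
  L0K G /\ forall Q, cube Q ->
    exists M : R, forall f, S0 (Krestrict Q G) f ->
      (\int[mu]_x (vnorm (f x))%:E <= M%:E)%E.

Definition Kavg (G : Rd -> set V) (Q : set Rd) : set V :=
  [set vavg Q f | f in S0 (Krestrict Q G)].

Definition MK (G : Rd -> set V) (x : Rd) : set V :=
  convex_hullK (\bigcup_(Q in [set Q | cube Q /\ Q x]) Kavg G Q).

(* The value of [fnorm] off [elt] is irrelevant. *)
Record fspace := FSpace { elt : set (Rd -> V); fnorm : (Rd -> V) -> R }.

(* The directional ideal property makes [elt] and [fnorm] invariant under a.e.
   equality. *)
Record dirBFS (X : fspace) : Prop := {
  dirBFS_L0 : elt X `<=` L0;
  dirBFS_0 : elt X (fun=> 0);
  dirBFS_add : forall f g, elt X f -> elt X g ->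
    elt X (fun x => f x + g x) /\
    fnorm X (fun x => f x + g x) <= fnorm X f + fnorm X g;
  dirBFS_scale : forall (a : F) f, elt X f ->
    elt X (fun x => a *: f x) /\ fnorm X (fun x => a *: f x) = sabs a * fnorm X f;
  dirBFS_ge0 : forall f, elt X f -> 0 <= fnorm X f;
  dirBFS_eq0 : forall f, elt X f -> fnorm X f = 0 -> ae_eq_fun f (fun=> 0);
  dirBFS_complete : forall u : nat -> Rd -> V, (forall m, elt X (u m)) ->
    (forall e : R, 0 < e -> exists N, forall i j, (N <= i)%N -> (N <= j)%N ->
       fnorm X (fun x => u i x - u j x) < e) ->
    exists2 f, elt X f &
      forall e : R, 0 < e -> exists N, forall i, (N <= i)%N ->
        fnorm X (fun x => u i x - f x) < e;
  dirBFS_ideal : forall f g, elt X f -> L0 g ->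
    {ae mu, forall x, Kvec (g x) `<=` Kvec (f x)} ->
    elt X g /\ fnorm X g <= fnorm X f;
  (* The integrals are required to exist: [sintegral] is meaningless otherwise. *)
  dirBFS_nondegenerate : forall g, L0 g ->
    (forall f, elt X f ->
       sintegrable (fun x => dot (f x) (g x)) /\
       sintegral setT (fun x => dot (f x) (g x)) = 0) ->
    ae_eq_fun g (fun=> 0)
}.

Definition kothe_norm (X : fspace) (g : Rd -> V) : \bar R :=
  ereal_sup [set (\int[mu]_x (sabs (dot (f x) (g x)))%:E)%E |
             f in [set f | elt X f /\ fnorm X f = 1]].

Definition kothe_dual (X : fspace) : fspace :=
  FSpace [set g | L0 g /\ (kothe_norm X g < +oo)%E]
         (fun g => fine (kothe_norm X g)).

Definition kothe_reflexive (X : fspace) : Prop :=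
  elt (kothe_dual (kothe_dual X)) = elt X /\
  forall f, elt X f -> fnorm (kothe_dual (kothe_dual X)) f = fnorm X f.

Definition XK (X : fspace) (G : Rd -> set V) : Prop :=
  [/\ L0K G, S0 G `<=` elt X & exists M : R, forall f, S0 G f -> fnorm X f <= M].

Definition XKnorm (X : fspace) (G : Rd -> set V) : R :=
  sup [set fnorm X f | f in S0 G].

Definition MK_bound (X : fspace) (C : R) : Prop :=
  [/\ 0 <= C, XK X `<=` L1locK &
      forall G, XK X G -> XK X (MK G) /\ XKnorm X (MK G) <= C * XKnorm X G].

Definition MK_bounded (X : fspace) : Prop := exists C, MK_bound X C.

Definition MK_opnorm (X : fspace) : R := inf [set C | MK_bound X C].

(* The part of Q that is not covered by the smaller cubes of S. *)
Definition major (S : set (set Rd)) (Q : set Rd) : set Rd :=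
  Q `\` \bigcup_(Q' in [set Q' | S Q' /\ Q' `<` Q]) Q'.

(* The sets [major S Q] are automatically disjoint when S is contained in a dyadic
   grid, the usual setting for the Carleson-type condition of the second clause.
   For general cubes the last clause cannot be dropped: the intervals [q, q + 1]
   with q rational, none of which strictly contains another, would otherwise form
   a sparse collection, although infinitely many of them contain any given
   point. *)
Definition sparse (S : set (set Rd)) : Prop :=
  [/\ S `<=` @cube R d,
      forall Q, S Q ->
        (mu (\bigcup_(Q' in [set Q' | S Q' /\ Q' `<` Q]) Q') <=
           (2^-1)%:E * mu Q)%E &
      forall Q Q', S Q -> S Q' -> Q <> Q' ->
        mu (major S Q `&` major S Q') = 0%E].

(* An operator between the quotients of [Linfc] and [L0] by a.e. equality. *)
Definition operator (T : (Rd -> V) -> (Rd -> V)) : Prop :=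
  (forall f, Linfc f -> L0 (T f)) /\
  (forall f g, Linfc f -> Linfc g -> ae_eq_fun f g -> ae_eq_fun (T f) (T g)).

Definition sparse_dominated (T : (Rd -> V) -> (Rd -> V)) (C : R) : Prop :=
  forall f, Linfc f -> exists2 S, sparse S &
    {ae mu, forall x, exists2 u : V,
       setsum S (fun Q => Krestrict Q (fun=> cavg f Q) x) u &
       T f x = rscale C u}.

End functions.

(* Main.v *)
Require Import Defs.
From HB Require Import structures.
From mathcomp Require Import all_boot all_order all_algebra.
From mathcomp Require Import all_classical all_reals all_analysis.
From mathcomp Require Import measurable_realfun.
From mathcomp.real_closed Require Import complex.
From mathcomp Require Import ring lra.

Set Implicit Arguments.
Unset Strict Implicit.
Unset Printing Implicit Defensive.

Import Order.TTheory GRing.Theory Num.Theory.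
Import numFieldNormedType.Exports.

Local Open Scope classical_set_scope.
Local Open Scope ring_scope.

(** By Koethe reflexivity, the norm of [T f] in [X] is the supremum of the
    integrals of |g . Tf| over the [g] of norm 1 in the Koethe dual of [X], so it
    suffices to bound these integrals ([sparse_pairing_le]).

    Almost everywhere, [T f x] lies in a closed sum of the averages <<f>>_Q over
    the cubes Q containing x of a sparse collection.  The set <<f>>_Q is bounded,
    hence its elements are linear combinations, with coefficients at most 3^n, of
    n elements e_(Q,1), ..., e_(Q,n) of <<f>>_Q itself ([bounded_set_frame]).
    Testing against g(x) is continuous, so that |g(x) . Tf(x)| is at most
    C_T 3^n times the sum of the |e_(Q,i) . g(x)| over i and Q
    ([setsum_sabs_dot]): the set-valued sum has become n scalar sparse sums.

    On one cube Q, rotating g by the phase of e . g shows that the integral of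
    |e . g| is at most |Q| |e . w| for some w in <<g>>_Q ([Kavg_aligned]).
    Sparseness provides disjoint sets E_Q in Q with |Q| <= 4 |E_Q|, and for x in
    E_Q the vectors e and w belong to M^K(K(f))(x) and M^K(K(g))(x).  Glueing the
    constants e and w along the sets E_Q therefore gives measurable selections F
    and G of these two maximal functions, and the sum over Q is at most four times
    the integral of |F . G|.  Duality between [X] and its Koethe dual
    ([kothe_holder]) and the two maximal bounds finish the proof
    ([sparse_form_le]); one may take C_n = 4 n 3^n.

    Two points of measure theory need care: a sparse collection has to be shown
    countable, and the union of the cubes of S strictly inside Q could a priori
    fail to be measurable.  Both are settled by a measurable set containing that
    union and of measure at most 3/4 |Q| ([sparse_major_hull]): removing it from Q
    leaves measurable sets of positive measure that are pairwise almost disjoint,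
    and there are only countably many of those in a sigma-finite space
    ([countable_ae_disjoint]). *)

(** * The scalar field and the scalar product *)

Section scalars_theory.
Context (R : realType) (k : scalar_field).
Local Notation F := (scalarF R k).
Implicit Types x y z : F.

Lemma sRe_is_additive x y : sRe (x + y) = sRe x + sRe y.
Proof. by case: k x y => //= -[a b] [c e]. Qed.

Lemma sIm_is_additive x y : sIm (x + y) = sIm x + sIm y.
Proof. by case: k x y => [x y|[a b] [c e]] //=; rewrite addr0. Qed.

Lemma sRe0 : sRe (0 : F) = 0. Proof. by case: k. Qed.
Lemma sIm0 : sIm (0 : F) = 0. Proof. by case: k. Qed.

Lemma sReN x : sRe (- x) = - sRe x.
Proof. by apply/eqP; rewrite -addr_eq0 -sRe_is_additive addNr sRe0. Qed.

Lemma sImN x : sIm (- x) = - sIm x.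
Proof. by apply/eqP; rewrite -addr_eq0 -sIm_is_additive addNr sIm0. Qed.

Lemma sReM x y : sRe (x * y) = sRe x * sRe y - sIm x * sIm y.
Proof. by case: k x y => [x y|[a b] [c e]] //=; rewrite mulr0 subr0. Qed.

Lemma sImM x y : sIm (x * y) = sRe x * sIm y + sIm x * sRe y.
Proof. by case: k x y => [x y|[a b] [c e]] //=; rewrite mulr0 mul0r addr0. Qed.

Lemma sRe_conj x : sRe (sconj x) = sRe x.
Proof. by case: k x => [x|[a b]]. Qed.

Lemma sIm_conj x : sIm (sconj x) = - sIm x.
Proof. by case: k x => [x|[a b]] //=; rewrite oppr0. Qed.

Lemma sRe_sC (a b : R) : sRe (sC k a b) = a.
Proof. by case: k. Qed.

Lemma sIm_sC0 (a : R) : sIm (sC k a 0) = 0.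
Proof. by case: k. Qed.

Lemma scalar_eq x y : sRe x = sRe y -> sIm x = sIm y -> x = y.
Proof. by case: k x y => [x y|[a b] [c e]] //= -> // ->. Qed.

Lemma sabsE x : sabs x = Num.sqrt (sRe x ^+ 2 + sIm x ^+ 2).
Proof.
rewrite /sabs; case: k x => [x|x]; first by rewrite /= expr0n addr0 sqrtr_sqr.
by rewrite (normc_def (x : R[i])).
Qed.

Lemma normE x : `|x| = sC k (sabs x) 0.
Proof. by rewrite /sabs; case: k x => [x|x]//; rewrite (normc_def (x : R[i])). Qed.

Lemma le_norm_sC x (a : R) : (`|x| <= sC k a 0) = (sabs x <= a).
Proof. by rewrite normE; case: k x => [x|x] //=; rewrite lecE eqxx. Qed.

Lemma lt_norm_sC x (a : R) : (`|x| < sC k a 0) = (sabs x < a).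
Proof. by rewrite normE; case: k x => [x|x] //=; rewrite ltcE eqxx. Qed.

Lemma sC1 : sC k 1 0 = 1 :> F. Proof. by case: k. Qed.
Lemma sC0 : sC k 0 0 = 0 :> F. Proof. by case: k. Qed.

Lemma le_norm1 x : (`|x| <= 1) = (sabs x <= 1).
Proof. by rewrite -sC1 le_norm_sC. Qed.

Lemma sabs_ge0 x : 0 <= sabs x.
Proof. by rewrite sabsE sqrtr_ge0. Qed.

Lemma sabs0 : sabs (0 : F) = 0.
Proof. by rewrite /sabs normr0 sRe0. Qed.

Lemma sabs0_eq0 x : sabs x = 0 -> x = 0.
Proof. by move=> h; apply/eqP; rewrite -normr_eq0 normE h sC0. Qed.

Lemma sabsM x y : sabs (x * y) = sabs x * sabs y.
Proof. by rewrite {1}/sabs normrM !normE sReM !sRe_sC !sIm_sC0 mulr0 subr0. Qed.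

Lemma sabsN x : sabs (- x) = sabs x.
Proof. by rewrite /sabs normrN. Qed.

Lemma sabsD x y : sabs (x + y) <= sabs x + sabs y.
Proof.
rewrite -le_norm_sC; apply: (le_trans (ler_normD _ _)); rewrite !normE.
by case: k x y => [x y|x y] //=; rewrite lecE /= addr0 !eqxx /=.
Qed.

Lemma sabsV x : sabs x^-1 = (sabs x)^-1.
Proof.
have [->|x0] := eqVneq x 0; first by rewrite invr0 sabs0 invr0.
have s0 : sabs x != 0 by apply: contra_neq x0 => /sabs0_eq0.
by apply: (mulIf s0); rewrite -sabsM !mulVf// /sabs normr1 -sC1 sRe_sC.
Qed.

Lemma sabs_conj x : sabs (sconj x) = sabs x.
Proof. by rewrite !sabsE sRe_conj sIm_conj sqrrN. Qed.

Lemma sabs_sC (a : R) : sabs (sC k a 0) = `|a|.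
Proof. by rewrite sabsE sRe_sC sIm_sC0 expr0n addr0 sqrtr_sqr. Qed.

Lemma sRe_le_sabs x : `|sRe x| <= sabs x.
Proof.
rewrite sabsE -[leLHS]sqrtr_sqr ler_sqrt ?lerDl ?sqr_ge0//.
by rewrite addr_ge0 ?sqr_ge0.
Qed.

Lemma sIm_le_sabs x : `|sIm x| <= sabs x.
Proof.
rewrite sabsE -[leLHS]sqrtr_sqr ler_sqrt ?lerDr ?sqr_ge0//.
by rewrite addr_ge0 ?sqr_ge0.
Qed.

Lemma sabs_le_reim x : sabs x <= `|sRe x| + `|sIm x|.
Proof.
rewrite sabsE -[leRHS]ger0_norm ?addr_ge0// -sqrtr_sqr ler_sqrt ?sqr_ge0//.
by rewrite sqrrD !real_normK ?num_real// lerD2r lerDl mulrn_wge0// mulr_ge0.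
Qed.

Lemma sRe_sum (I : Type) (s : seq I) (P : pred I) (f : I -> F) :
  sRe (\sum_(i <- s | P i) f i) = \sum_(i <- s | P i) sRe (f i).
Proof. exact: (big_morph _ sRe_is_additive sRe0). Qed.

Lemma sIm_sum (I : Type) (s : seq I) (P : pred I) (f : I -> F) :
  sIm (\sum_(i <- s | P i) f i) = \sum_(i <- s | P i) sIm (f i).
Proof. exact: (big_morph _ sIm_is_additive sIm0). Qed.

Lemma sabs_sum (I : Type) (s : seq I) (P : pred I) (f : I -> F) :
  sabs (\sum_(i <- s | P i) f i) <= \sum_(i <- s | P i) sabs (f i).
Proof.
elim/big_rec2 : _ => [|i a b _ h]; first by rewrite sabs0.
by apply: (le_trans (sabsD _ _)); rewrite lerD2l.
Qed.

Lemma sRe_mul_conj x : sRe (x * sconj x) = sabs x ^+ 2.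
Proof.
rewrite sReM sRe_conj sIm_conj mulrN opprK sabsE sqr_sqrtr -?expr2//.
by rewrite addr_ge0 ?sqr_ge0.
Qed.

Section dot.
Variable n : nat.
Implicit Types u v w : 'rV[F]_n.

Lemma dotDr u v w : dot u (v + w) = dot u v + dot u w.
Proof.
rewrite /dot -big_split /=; apply: eq_bigr => i _; rewrite mxE -mulrDr.
congr (_ * _); apply: scalar_eq; rewrite ?(sRe_conj, sIm_conj, sRe_is_additive, sIm_is_additive)//.
by rewrite opprD.
Qed.

Lemma sabs_dotC u v : sabs (dot u v) = sabs (dot v u).
Proof.
suff -> : dot u v = sconj (dot v u) by rewrite sabs_conj.
apply: scalar_eq; rewrite ?sRe_conj ?sIm_conj /dot ?sRe_sum ?sIm_sum -?sumrN; apply: eq_bigr => i _.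
  by rewrite !sReM !sRe_conj !sIm_conj; ring.
by rewrite !sImM !sRe_conj !sIm_conj; ring.
Qed.

Lemma sconjM x y : sconj (x * y) = sconj x * sconj y.
Proof.
apply: scalar_eq; rewrite ?(sReM, sImM, sRe_conj, sIm_conj)//; first by ring.
by ring.
Qed.

Lemma dotZr u a v : dot u (a *: v) = sconj a * dot u v.
Proof.
by rewrite /dot mulr_sumr; apply: eq_bigr => i _; rewrite mxE sconjM mulrCA.
Qed.

Lemma dotZl u a v : dot (a *: u) v = a * dot u v.
Proof. by rewrite /dot mulr_sumr; apply: eq_bigr => i _; rewrite mxE mulrA. Qed.

Lemma sabs_dotZr u a v : sabs (dot u (a *: v)) = sabs a * sabs (dot u v).
Proof. by rewrite dotZr sabsM sabs_conj. Qed.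

Lemma dot0r u : dot u 0 = 0.
Proof. by rewrite -[X in dot u X](scale0r (0 : 'rV[F]_n)) dotZr -sC0; apply: scalar_eq;
  rewrite ?sReM ?sImM ?sRe_conj ?sIm_conj sC0 sRe0 sIm0; ring. Qed.

Lemma dot0l u : dot 0 u = 0.
Proof. by rewrite -[X in dot X _](scale0r (0 : 'rV[F]_n)) dotZl mul0r. Qed.

Lemma dot_sumr u (I : Type) (s : seq I) (v : I -> 'rV[F]_n) :
  dot u (\sum_(i <- s) v i) = \sum_(i <- s) dot u (v i).
Proof. exact: (big_morph _ (dotDr u) (dot0r u)). Qed.

Lemma sabs_dot_le u v (e : R) : (forall j, sabs (v 0 j) <= e) ->
  sabs (dot u v) <= (\sum_j sabs (u 0 j)) * e.
Proof.
move=> ve; rewrite mulr_suml; apply: (le_trans (sabs_sum _ _ _)).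
by apply: ler_sum => j _; rewrite sabsM sabs_conj ler_wpM2l ?sabs_ge0.
Qed.

Lemma sRe_dot u v :
  sRe (dot u v) = \sum_j (sRe (u 0 j) * sRe (v 0 j) + sIm (u 0 j) * sIm (v 0 j)).
Proof.
rewrite /dot sRe_sum; apply: eq_bigr => j _.
by rewrite sReM sRe_conj sIm_conj mulrN opprK.
Qed.

Lemma sIm_dot u v :
  sIm (dot u v) = \sum_j (sIm (u 0 j) * sRe (v 0 j) - sRe (u 0 j) * sIm (v 0 j)).
Proof.
rewrite /dot sIm_sum; apply: eq_bigr => j _.
by rewrite sImM sRe_conj sIm_conj mulrN addrC.
Qed.

Lemma sabs_le_vnorm u j : sabs (u 0 j) <= vnorm u.
Proof.
rewrite /vnorm -[leLHS]ger0_norm ?sabs_ge0// -sqrtr_sqr ler_sqrt; last first.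
  by apply: sumr_ge0 => i _; exact: sqr_ge0.
by rewrite (bigD1 j)//= lerDl; apply: sumr_ge0 => i _; exact: sqr_ge0.
Qed.

End dot.
End scalars_theory.

(** * Topology and measurability of vector valued functions *)
Section topology_of_vectors.
Context (R : realType) (k : scalar_field) (n : nat).
Local Notation F := (scalarF R k).
Local Notation V := 'rV[F]_n.

(** The topology of F^n is that of the real quantities [sabs]; this hides that
    MathComp balls have radii in F, hence in R[i] when the scalars are complex. *)
Lemma nbhs_sabsP (u : V) (U : set V) : nbhs u U <->
  exists2 e : R, 0 < e & forall v : V, (forall j, sabs (u 0 j - v 0 j) < e) -> U v.
Proof.
split.
- move=> /nbhs_ballP[e /= e0 eU].
  have eE : e = sC k (sabs e) 0 by rewrite -normE gtr0_norm.
  exists (sabs e) => [|v uv].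
    rewrite lt_neqAle sabs_ge0 andbT eq_sym; apply/eqP => /sabs0_eq0 e00.
    by move: e0; rewrite e00 ltxx.
  apply: eU; split=> // i j; rewrite (ord1 i) /ball /= eE.
  by rewrite lt_norm_sC.
- move=> [e e0 eU]; apply/nbhs_ballP.
  have se0 : 0 < sC k e 0 :> F.
    by rewrite -(@sC0 R k); case: (k) => //=; rewrite ltcE /= eqxx.
  exists (sC k e 0) => //= v [_ uv].
  by apply: eU => j; rewrite -lt_norm_sC; exact: uv.
Qed.

Lemma sRe_continuous : continuous (@sRe R k).
Proof.
move=> z U /nbhs_ballP[e /= e0 eU]; apply/nbhs_ballP; exists (sC k e 0) => [|t zt] /=.
  by rewrite -(@sC0 R k); case: (k) => //=; rewrite ltcE /= eqxx.
apply: eU; rewrite /ball /= -sReN -sRe_is_additive (le_lt_trans (sRe_le_sabs _))//.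
by rewrite -lt_norm_sC.
Qed.

Lemma sIm_continuous : continuous (@sIm R k).
Proof.
move=> z U /nbhs_ballP[e /= e0 eU]; apply/nbhs_ballP; exists (sC k e 0) => [|t zt] /=.
  by rewrite -(@sC0 R k); case: (k) => //=; rewrite ltcE /= eqxx.
apply: eU; rewrite /ball /= -sImN -sIm_is_additive (le_lt_trans (sIm_le_sabs _))//.
by rewrite -lt_norm_sC.
Qed.

Lemma closed_sabs_dot (a : V) (c : R) : closed [set w : V | sabs (dot a w) <= c].
Proof.
rewrite -openC openE => u /= /negP; rewrite -ltNge => cu; apply/nbhs_sabsP.
set s := \sum_j sabs (a 0 j).
have s0 : 0 <= s by apply: sumr_ge0 => j _; exact: sabs_ge0.
have s1 : 0 < s + 1 by rewrite ltr_wpDl.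
pose e := (sabs (dot a u) - c) / (s + 1).
exists e => [|v uv /= vc]; first by rewrite divr_gt0 ?subr_gt0.
have := @sabs_dot_le R k n a (u - v) e.
have uvj j : sabs ((u - v) 0 j) <= e by rewrite !mxE; exact/ltW/uv.
move=> /(_ uvj) h.
have e0 : 0 < e by rewrite divr_gt0 ?subr_gt0.
have hh : sabs (dot a u) <= sabs (dot a (u - v)) + sabs (dot a v).
  by rewrite -[dot a u](_ : dot a (u - v) + dot a v = _) ?sabsD// -dotDr subrK.
have : sabs (dot a u) - c <= s * e.
  by rewrite lerBlDr (le_trans hh)// lerD.
rewrite leNgt => /negP; apply.
rewrite [ltRHS](_ : _ = (s + 1) * e); last by rewrite /e mulrC divfK ?gt_eqF.
by rewrite ltr_pM2r// ltrDl.
Qed.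

(** The bound that passes through the closures in Minkowski sums. *)
Lemma closure_sabs_dot (a : V) (c : R) (A : set V) :
  (forall w, A w -> sabs (dot a w) <= c) ->
  forall w, closure A w -> sabs (dot a w) <= c.
Proof.
move=> Ac w; rewrite closureEbigcap => /(_ [set w | sabs (dot a w) <= c]).
by apply; split => //; exact: closed_sabs_dot.
Qed.

End topology_of_vectors.

Section borel_functions.
Context (R : realType) (k : scalar_field) (d n : nat).
Local Notation F := (scalarF R k).
Local Notation V := 'rV[F]_n.
Local Notation Rd := (Rd R d).

Lemma borel_fun_preimage (W : ptopologicalType) (f : Rd -> W) (U : set W) :
  borel_fun f -> open U -> measurable (f @^-1` U).
Proof.
move=> mf oU; rewrite -[X in measurable X]setTI; apply: (mf) => //.
exact: sub_sigma_algebra.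
Qed.

Lemma borel_fun_opens (W : ptopologicalType) (f : Rd -> W) :
  (forall U, open U -> measurable (f @^-1` U)) -> borel_fun f.
Proof.
move=> h; apply: (@measurability _ _ _ (g_sigma_algebraType (@open W)) _ _ (@open W)) => //.
by move=> _ [U oU <-]; rewrite setTI; exact: h.
Qed.

Lemma measurable_opens (f : Rd -> R) :
  (forall U : set R, open U -> measurable (f @^-1` U)) -> measurable_fun setT f.
Proof.
move=> h; apply: (measurability _ (RGenOpens.measurableE R)) => //.
move=> _ [_ [a [b ->]] <-]; rewrite setTI; apply: h; exact: interval_open.
Qed.

Lemma L0_sRe (f : Rd -> V) j : L0 f -> measurable_fun setT (fun x => sRe (f x 0 j)).
Proof.
move=> mf; apply: measurable_opens => U oU.
apply: (borel_fun_preimage mf (U := [set u : V | U (sRe (u 0 j))])).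
apply: (@open_comp _ _ (fun u : V => sRe (u 0 j))) => // u _.
by apply: continuous_comp; [exact: coord_continuous|exact: sRe_continuous].
Qed.

Lemma L0_sIm (f : Rd -> V) j : L0 f -> measurable_fun setT (fun x => sIm (f x 0 j)).
Proof.
move=> mf; apply: measurable_opens => U oU.
apply: (borel_fun_preimage mf (U := [set u : V | U (sIm (u 0 j))])).
apply: (@open_comp _ _ (fun u : V => sIm (u 0 j))) => // u _.
by apply: continuous_comp; [exact: coord_continuous|exact: sIm_continuous].
Qed.

(* The rational boxes form a countable base of F^n; over R the imaginary parts
   vanish and their centres are harmless. *)
Let box (c : {ffun 'I_n -> rat * rat}) (r : rat) : set V :=
  [set v | forall j, `|sRe (v 0 j) - ratr (c j).1| < ratr r /\
                     `|sIm (v 0 j) - ratr (c j).2| < ratr r].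

Lemma open_bigcup_box (U : set V) : open U ->
  U = \bigcup_(p in [set p : {ffun 'I_n -> rat * rat} * rat | box p.1 p.2 `<=` U])
        box p.1 p.2.
Proof.
move=> oU; apply/seteqP; split => [u Uu|u [p pU pu]]; last exact: pU.
have /nbhs_sabsP[e e0 eU] : nbhs u U by exact: open_nbhs_nbhs.
have e40 : 0 < e / 4 by rewrite divr_gt0.
have [r] := rat_in_itvoo e40; rewrite in_itv /= => /andP[r0 re].
have near (a : R) : {q : rat | `|a - ratr q| < ratr r}.
  apply: cid; have : a - ratr r < a + ratr r by lra.
  move=> /rat_in_itvoo[q]; rewrite in_itv /= => /andP[q1 q2]; exists q.
  by rewrite ltr_norml; apply/andP; split; lra.
exists ([ffun j => (sval (near (sRe (u 0 j))), sval (near (sIm (u 0 j))))], r) => /=.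
  move=> v vb; apply: eU => j; apply: (le_lt_trans (sabs_le_reim _)).
  have := vb j; rewrite !ffunE /= => -[v1 v2].
  have := svalP (near (sRe (u 0 j))); have := svalP (near (sIm (u 0 j))).
  rewrite sRe_is_additive sIm_is_additive sReN sImN.
  move: v1 v2; rewrite !ltr_norml => /andP[? ?] /andP[? ?] /andP[? ?] /andP[? ?].
  have -> : e = e / 2 + e / 2 by lra.
  by apply: ltrD; rewrite ltr_norml; apply/andP; split; lra.
by move=> j; rewrite !ffunE /=; split; [exact: (svalP (near (sRe _)))|exact: (svalP (near (sIm _)))].
Qed.

(** F^n is second countable, so measurability may be tested on the real and
    imaginary parts of the coordinates; this is what makes products and linear
    combinations of measurable functions measurable. *)
Lemma L0_coords (f : Rd -> V) :
  (forall j, measurable_fun setT (fun x => sRe (f x 0 j)) /\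
             measurable_fun setT (fun x => sIm (f x 0 j))) -> L0 f.
Proof.
move=> mf; apply: borel_fun_opens => U /open_bigcup_box ->.
rewrite preimage_bigcup bigcup_mkcond; apply: countable_bigcupT_measurable => // p.
case: ifPn => // _.
rewrite (_ : _ @^-1` _ = \bigcap_(j in [set: 'I_n])
    (((fun x => `|sRe (f x 0 j) - ratr (p.1 j).1|) @^-1` `]-oo, ratr p.2[%classic) `&`
    ((fun x => `|sIm (f x 0 j) - ratr (p.1 j).2|) @^-1` `]-oo, ratr p.2[%classic))).
  apply: fin_bigcap_measurable => // j _; have [mRe mIm] := mf j.
  apply: measurableI; rewrite -[X in measurable X]setTI.
    by apply: (measurableT_comp (@normr_measurable R setT) (measurable_funB mRe (measurable_cst _))).
  by apply: (measurableT_comp (@normr_measurable R setT) (measurable_funB mIm (measurable_cst _))).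
apply/seteqP; split => [x h j _|x h j].
  by have := h j; rewrite /= !in_itv.
by have := h j I; rewrite /= !in_itv.
Qed.

(** Measurability of a scalar function, in a form that the algebraic operations
    preserve. *)
Definition smeasurable (h : Rd -> F) : Prop :=
  measurable_fun setT (fun x => sRe (h x)) /\
  measurable_fun setT (fun x => sIm (h x)).

Lemma smeasurable_dot (f g : Rd -> V) : L0 f -> L0 g ->
  smeasurable (fun x => dot (f x) (g x)).
Proof.
move=> mf mg; split.
  under eq_fun do rewrite sRe_dot; apply: measurable_sum => j.
  exact: measurable_funD (measurable_funM (L0_sRe j mf) (L0_sRe j mg))
                         (measurable_funM (L0_sIm j mf) (L0_sIm j mg)).
under eq_fun do rewrite sIm_dot; apply: measurable_sum => j.
exact: measurable_funB (measurable_funM (L0_sIm j mf) (L0_sRe j mg))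
                       (measurable_funM (L0_sRe j mf) (L0_sIm j mg)).
Qed.

Lemma smeasurable_sabs (h : Rd -> F) : smeasurable h ->
  measurable_fun setT (fun x => sabs (h x)).
Proof.
move=> [hr hi]; under eq_fun do rewrite sabsE.
exact: (measurableT_comp (continuous_measurable_fun (@sqrt_continuous R))
  (measurable_funD (measurable_funX 2 hr) (measurable_funX 2 hi))).
Qed.

Lemma smeasurable_real (c : Rd -> R) (h : Rd -> F) :
  measurable_fun setT c -> smeasurable h -> smeasurable (fun x => sC k (c x) 0 * h x).
Proof.
move=> mc [hr hi]; split.
  under eq_fun do rewrite sReM sIm_sC0 mul0r subr0 sRe_sC.
  exact: measurable_funM mc hr.
under eq_fun do rewrite sImM sIm_sC0 mul0r addr0 sRe_sC.
exact: measurable_funM mc hi.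
Qed.

Lemma smeasurable_cst (z : F) : smeasurable (fun=> z).
Proof. by split; exact: measurable_cst. Qed.

Lemma smeasurable_coord (f : Rd -> V) j : L0 f -> smeasurable (fun x => f x 0 j).
Proof. by move=> mf; split; [exact: L0_sRe|exact: L0_sIm]. Qed.

Lemma borel_fun_smeasurable (h : Rd -> F) : borel_fun h -> smeasurable h.
Proof.
move=> mh; split; apply: measurable_opens => U oU.
  have o : open [set z : F | U (sRe z)].
    by apply: (@open_comp _ _ (@sRe R k)) => // z _; exact: sRe_continuous.
  exact: (borel_fun_preimage mh o).
have o : open [set z : F | U (sIm z)].
  by apply: (@open_comp _ _ (@sIm R k)) => // z _; exact: sIm_continuous.
exact: (borel_fun_preimage mh o).
Qed.

Lemma measurable_sabs_dot (f g : Rd -> V) : L0 f -> L0 g ->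
  measurable_fun setT (fun x => sabs (dot (f x) (g x))).
Proof. by move=> mf mg; exact: smeasurable_sabs (smeasurable_dot mf mg). Qed.

Lemma measurable_vnorm (f : Rd -> V) : L0 f ->
  measurable_fun setT (fun x => vnorm (f x)).
Proof.
move=> mf; apply: (measurableT_comp (continuous_measurable_fun (@sqrt_continuous R))).
apply: measurable_sum => j; apply: measurable_funX.
exact: smeasurable_sabs (smeasurable_coord j mf).
Qed.

Lemma L0_cst (v : V) : L0 (fun _ : Rd => v).
Proof. by apply: L0_coords => j; split; exact: measurable_cst. Qed.

Lemma L0_scale (h : Rd -> F) (f : Rd -> V) :
  smeasurable h -> L0 f -> L0 (fun x => h x *: f x).
Proof.
move=> [hr hi] mf; apply: L0_coords => j; split.
  under eq_fun do rewrite mxE sReM.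
  exact: measurable_funB (measurable_funM hr (L0_sRe j mf)) (measurable_funM hi (L0_sIm j mf)).
under eq_fun do rewrite mxE sImM.
exact: measurable_funD (measurable_funM hr (L0_sIm j mf)) (measurable_funM hi (L0_sRe j mf)).
Qed.

End borel_functions.

(** * Lebesgue measure of cubes, and outer regularity *)
Section lebesgue_cubes.
Context (R : realType).
Local Notation RR := (measurableTypeR R).

Lemma borel_leb_box d (J : 'I_d -> set RR) :
  (forall i, measurable (J i)) ->
  (forall i, 0 < @lebesgue_measure R (J i) < +oo)%E ->
  measurable [set t : d.-tuple RR | forall i, J i (tnth t i)] /\
  (0 < borel_leb R d [set t | forall i, J i (tnth t i)] < +oo)%E.
Proof.
elim: d J => [|d IH] J mJ Joo.
  have -> : [set t : 0.-tuple RR | forall i, J i (tnth t i)] = setT.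
    by apply/seteqP; split => // t _ [].
  by split => //=; rewrite diracT lte01 ltry.
have [mB Boo] := IH (fun i => J (lift ord0 i)) (fun i => mJ _) (fun i => Joo _).
split.
  rewrite (_ : mkset _ = \bigcap_(i in [set: 'I_d.+1]) ((fun t => tnth t i) @^-1` J i)).
    apply: fin_bigcap_measurable => // i _; rewrite -[X in measurable X]setTI.
    exact: (measurable_tnth i).
  by apply/seteqP; split => [t h i _|t h i]; [exact: h|exact: (h i I)].
rewrite /= /leb_step /pushforward.
set B := [set t | _] in mB Boo.
have -> : @cons_pair R d @^-1` [set t | forall i, J i (tnth t i)] = J ord0 `*` B.
  apply/seteqP; split => [[x t] /= h|[x t] /= [h1 h2] i].
    split; first by have := h ord0; rewrite (tnth_nth 0).
    by move=> i; have := h (lift ord0 i); rewrite !(tnth_nth 0).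
  case: (unliftP ord0 i) => [j ->|->]; last by rewrite (tnth_nth 0).
  by have := h2 j; rewrite !(tnth_nth 0).
rewrite product_measure1E//.
have /andP[J0 J1] := Joo ord0; have /andP[B0 B1] := Boo.
by rewrite mule_gt0//= lte_mul_pinfty// ?ge0_fin_numE// ltW.
Qed.

Lemma borel_measurable d (A : set (d.-tuple RR)) :
  measurable A -> measurable (A : set (Rd R d)).
Proof. exact: caratheodory_measurable_mu_ext. Qed.

Lemma lebE d (A : set (d.-tuple RR)) : measurable A -> leb R d A = borel_leb R d A.
Proof. exact: measurable_mu_extE. Qed.

Lemma cubeP d (Q : set (Rd R d)) : cube Q ->
  measurable Q /\ (0 < leb R d Q < +oo)%E.
Proof.
move=> [a [l [bl [br [l0 ->]]]]].
pose J i : set RR := [set` Interval (BSide bl (tnth a i)) (BSide br (tnth a i + l))].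
have mJ i : measurable (J i) by exact: measurable_itv.
have Joo i : (0 < @lebesgue_measure R (J i) < +oo)%E.
  rewrite lebesgue_measure_itv /= lte_fin ltrDl l0 -EFinD addrAC subrr add0r.
  by rewrite lte_fin l0 ltry.
have [mB Boo] := borel_leb_box mJ Joo.
split; first exact: borel_measurable.
by rewrite lebE.
Qed.

Lemma leb_sigma_finite d : exists2 G : (set (Rd R d))^nat,
  \bigcup_i G i = setT & forall i, measurable (G i) /\ (leb R d (G i) < +oo)%E.
Proof.
have [G TG Goo] := sigma_finiteT (borel_leb R d).
exists G => // i; have [mG Gi] := Goo i.
by split; [exact: borel_measurable|rewrite lebE].
Qed.

(** Here and in [leb_hull] the sets are arbitrary: [leb] is an outer measure, and
    [sparse] evaluates it on unions whose measurability is not known yet. *)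
Lemma leb_le d (A B : set (Rd R d)) : A `<=` B -> (leb R d A <= leb R d B)%E.
Proof. exact: (@le_mu_ext _ (d.-tuple RR) R (borel_leb R d) A B). Qed.

(** The outer measure is an infimum over countable covers by Borel sets, and the
    union of such a cover is measurable. *)
Lemma leb_hull d (U : set (Rd R d)) (e : R) : 0 < e -> (leb R d U < +oo)%E ->
  exists V, [/\ measurable V, U `<=` V & (leb R d V <= leb R d U + e%:E)%E].
Proof.
move=> e0 Uoo.
have Ufin : leb R d U \is a fin_num by rewrite ge0_fin_numE// mu_ext_ge0.
have [_ [G [mG UG] <-] Gle] := lb_ereal_inf_adherent e0 Ufin.
exists (\bigcup_i G i); split => //.
  by apply: bigcupT_measurable => i; apply: borel_measurable; exact: mG.
apply: le_trans (ltW Gle).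
have mG' i : measurable (G i : set (Rd R d)) by apply: borel_measurable; exact: mG.
rewrite (eq_eseriesr (fun i _ => esym (lebE (mG i)))).
by apply: measure_sigma_subadditive => //; exact: bigcupT_measurable.
Qed.

End lebesgue_cubes.

(** * Almost disjoint sets of positive measure *)
Section almost_disjoint.
Context d (T : measurableType d) (R : realType) (mu : {measure set T -> \bar R}).

Lemma measure_seqDU_ae (E : (set T)^nat) : (forall m, measurable (E m)) ->
  (forall i j, i <> j -> mu (E i `&` E j) = 0%E) ->
  forall m, mu (seqDU E m) = mu (E m).
Proof.
move=> mE E0 m; rewrite [RHS](@measureDI _ _ _ mu _ (\big[setU/set0]_(k < m) E k))//; last first.
  by apply: bigsetU_measurable.
rewrite [X in (_ + X)%E](_ : _ = 0%E) ?adde0//.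
apply/negligibleP.
  by apply: measurableI => //; apply: bigsetU_measurable.
rewrite -bigcup_mkord setI_bigcupr; apply: (@negligibleS _ _ _ mu (\bigcup_i (if (i < m)%N then E m `&` E i else set0))).
  by move=> x [i /= im Ex]; exists i => //; rewrite im.
apply: negligible_bigcup => i; case: ifPn => im; last exact: negligible_set0.
apply/negligibleP; first exact: measurableI.
by apply: E0 => mi; rewrite mi ltnn in im.
Qed.

(** Inside a set of finite measure, only finitely many almost disjoint sets can
    have measure more than 1/(m+1); the collection is a countable union of such
    finite ones. *)
Lemma countable_ae_disjoint (I : pointedType) (S : set I) (E : I -> set T) (G : (set T)^nat) :
  \bigcup_i G i = setT -> (forall i, measurable (G i) /\ (mu (G i) < +oo)%E) ->
  (forall i, S i -> measurable (E i) /\ (0 < mu (E i))%E) ->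
  (forall i j, S i -> S j -> i <> j -> mu (E i `&` E j) = 0%E) ->
  countable S.
Proof.
move=> GT Goo Epos E0.
pose A (p : nat * nat) : set I :=
  [set i | S i /\ ((p.2.+1%:R^-1)%:E < mu (E i `&` G p.1))%E].
suff fA p : finite_set (A p).
  apply: (@sub_countable _ _ _ (\bigcup_p A p)); last first.
    by apply: bigcup_countable => // p _; exact: finite_set_countable.
  apply: subset_card_le => i Si; have [mE Ei] := Epos _ Si.
  have [N EN] : exists N, (0 < mu (E i `&` G N))%E.
    apply: contrapT => /forallNP h.
    suff : mu (E i) = 0%E by move=> h0; rewrite h0 ltxx in Ei.
    apply/negligibleP => //; rewrite -(setIT (E i)) -GT setI_bigcupr.
    apply: negligible_bigcup => N; apply/negligibleP.
      by apply: measurableI => //; have [] := Goo N.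
    by apply/eqP; rewrite eq_le measure_ge0 andbT leNgt; apply/negP/h.
  have EGfin : mu (E i `&` G N) \is a fin_num.
    rewrite ge0_fin_numE//; have [mG] := Goo N; apply: le_lt_trans.
    by apply: le_measure; rewrite ?inE//; exact: measurableI.
  have [m mE'] : exists m, (m.+1%:R^-1 < fine (mu (E i `&` G N))).
    have f0 : 0 < fine (mu (E i `&` G N)) by rewrite fine_gt0// EN -ge0_fin_numE.
    exists (Num.trunc (fine (mu (E i `&` G N)))^-1).
    by rewrite invf_plt ?posrE// truncnS_gt.
  by exists (N, m) => //; split => //=; rewrite -(fineK EGfin) lte_fin.
(* Infinitely many of them would fill up more than the measure of [G p.1]. *)
apply: contrapT => /infiniteP /pcard_leP[f].
have fS j : A p (f j) by exact: ('funS_f Logic.I).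
pose B j := E (f j) `&` G p.1.
have mB j : measurable (B j).
  apply: measurableI; last by have [] := Goo p.1.
  by have [] := Epos _ (fS j).1.
have B0 i j : i <> j -> mu (B i `&` B j) = 0%E.
  move=> ij; apply/eqP; rewrite eq_le measure_ge0 andbT.
  rewrite -(E0 (f i) (f j) (fS i).1 (fS j).1); last first.
    by move=> fij; apply: ij; apply: (@inj _ _ _ f) => //; rewrite in_setT.
  apply: le_measure; rewrite ?inE; [exact: measurableI| |by move=> x [[? ?] [? ?]]].
  by apply: measurableI; [have [] := (Epos _ (fS i).1)|have [] := (Epos _ (fS j).1)].
have [mG Gfin] := Goo p.1.
have Gf : mu (G p.1) \is a fin_num by rewrite ge0_fin_numE.
set r : R := p.2.+1%:R^-1.
have r0 : 0 < r by rewrite invr_gt0.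
have sumle N : r * N%:R <= fine (mu (G p.1)).
  rewrite -lee_fin fineK//.
  have : (mu (\bigcup_j seqDU B j) <= mu (G p.1))%E.
    apply: le_measure; rewrite ?inE//.
      by apply: bigcupT_measurable; exact: seqDU_measurable.
    by move=> x [j _ Bx]; have [] := subset_seqDU Bx.
  rewrite measure_bigcup; [|by move=> j _; exact: seqDU_measurable|exact: trivIset_seqDU].
  apply: le_trans; rewrite (eq_eseriesl (Q := xpredT)); last by move=> j; rewrite in_setT.
  apply: le_trans (nneseries_lim_ge N _) => //.
  apply: (@le_trans _ _ (\sum_(0 <= i < N) r%:E)%E).
    by rewrite sumEFin lee_fin big_const_nat subn0 iter_addr addr0 mulr_natr.
  apply: lee_sum => j _; rewrite measure_seqDU_ae//; exact: ltW (fS j).2.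
have := sumle (Num.trunc (fine (mu (G p.1)) / r)).+1.
by rewrite mulrC -ler_pdivlMr// leNgt truncnS_gt.
Qed.

End almost_disjoint.

(** * Sparse collections *)
Section sparse_families.
Context (R : realType) (d : nat).
Local Notation Rd := (Rd R d).
Local Notation mu := (leb R d).

(** The union U of the smaller cubes has outer measure at most |Q|/2, so a
    measurable V containing U has measure at most |Q|/2 + |Q|/4; take Q minus V.
    The slack |Q|/4 is the reason for the constant 4. *)
Lemma sparse_major_hull (S : set (set Rd)) : sparse S -> exists E : set Rd -> set Rd,
  forall Q, S Q -> [/\ measurable (E Q), E Q `<=` major S Q &
                       (mu Q <= 4%:E * mu (E Q))%E].
Proof.
have lin (q a i : R) : i <= 2^-1 * q + q / 4 -> q = a + i -> q <= 4 * a by lra.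
move=> [Scube Ssmall _].
suff h Q : exists EQ, S Q -> [/\ measurable EQ, EQ `<=` major S Q &
                       (mu Q <= 4%:E * mu EQ)%E] by have [E ?] := choice h; exists E.
have [SQ|nSQ] := pselect (S Q); last by exists set0.
have [mQ /andP[Q0 Qoo]] := cubeP (Scube _ SQ).
have Qfin : mu Q \is a fin_num by rewrite ge0_fin_numE// ltW.
have q0 : 0 < fine (mu Q) by rewrite fine_gt0// Q0.
have Usmall := Ssmall _ SQ; set U := \bigcup_(_ in _) _ in Usmall.
have Uoo : (mu U < +oo)%E by apply: (le_lt_trans Usmall); rewrite lte_mul_pinfty.
have q4 : 0 < fine (mu Q) / 4 by rewrite divr_gt0.
have [V [mV UV VU]] := leb_hull q4 Uoo.
exists (Q `\` V) => _; split; first exact: measurableD.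
  by move=> x [Qx Vx]; split => // Ux; apply: Vx; exact: UV.
have mD : (mu (Q `\` V) <= mu Q)%E by apply: le_measure; rewrite ?inE//; exact: measurableD.
have Dfin : mu (Q `\` V) \is a fin_num by rewrite ge0_fin_numE// (le_lt_trans mD).
have mI : (mu (Q `&` V) <= mu V)%E by apply: le_measure; rewrite ?inE//; exact: measurableI.
have VQ : (mu V <= (2^-1 * fine (mu Q) + fine (mu Q) / 4)%:E)%E.
  apply: (le_trans VU); rewrite EFinD leeD2r//.
  by apply: (le_trans Usmall); rewrite EFinM fineK.
have Ifin : mu (Q `&` V) \is a fin_num.
  by rewrite ge0_fin_numE// (le_lt_trans mI)// (le_lt_trans VQ)// ltry.
have IQ := le_trans mI VQ.
have := measureDI mu mQ mV.
move=> QE.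
have {}QE : fine (mu Q) = fine (mu (Q `\` V)) + fine (mu (Q `&` V)).
  by rewrite -fineD// -QE.
rewrite -(fineK Qfin) -(fineK Dfin) -EFinM.
by rewrite lee_fin; apply: lin QE; rewrite -lee_fin fineK.
Qed.

Lemma sparse_countable (S : set (set Rd)) : sparse S -> countable S.
Proof.
move=> spS; have [E hE] := sparse_major_hull spS.
have [Scube _ Sdisj] := spS; have [G GT Goo] := leb_sigma_finite R d.
apply: (countable_ae_disjoint (mu := mu) (E := E) GT Goo).
  move=> Q SQ; have [mE _ QE] := hE _ SQ; split => //.
  have [_ /andP[Q0 _]] := cubeP (Scube _ SQ).
  rewrite lt0e measure_ge0 andbT; apply/eqP => E0; rewrite E0 mule0 in QE.
  by rewrite ltNge QE in Q0.
move=> Q Q' SQ SQ' QQ'; apply/eqP; rewrite eq_le measure_ge0 andbT.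
rewrite -(Sdisj _ _ SQ SQ' QQ'); apply: leb_le.
by apply: setISS; [have [] := hE _ SQ|have [] := hE _ SQ'].
Qed.

(** An enumeration along an injection [iota] into nat; indices that are not
    values of [iota] get the empty set.  The sets of [sparse_major_hull] are made
    disjoint at no cost in measure. *)
Lemma sparse_sequence (S : set (set Rd)) : sparse S ->
  exists Q E : (set Rd)^nat, [/\
    forall m, S (Q m) \/ Q m = set0,
    forall m, measurable (E m) /\ E m `<=` Q m,
    trivIset setT E,
    forall m, (mu (Q m) <= 4%:E * mu (E m))%E &
    exists iota : set Rd -> nat, {in S &, injective iota} /\
      forall P, S P -> Q (iota P) = P].
Proof.
move=> spS; have [E hE] := sparse_major_hull spS.
have [Scube _ Sdisj] := spS.
have /countable_injP[iota iotaI] := sparse_countable spS.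
pose Q m := xget set0 [set P | S P /\ iota P = m].
have QP m : (S (Q m) /\ iota (Q m) = m) \/ Q m = set0.
  by rewrite /Q; case: xgetP => [P _ [SP <-]|_]; [left|right].
pose E1 m := if `[< S (Q m) /\ iota (Q m) = m >] then E (Q m) else set0.
have mE1 m : measurable (E1 m).
  by rewrite /E1; case: asboolP => // -[SQ _]; have [] := hE _ SQ.
have E1Q m : E1 m `<=` Q m.
  rewrite /E1; case: asboolP => [[SQ _]|_]; last exact: sub0set.
  by have [_ EM _] := hE _ SQ; move=> x /EM[].
have E1Qmu m : (mu (Q m) <= 4%:E * mu (E1 m))%E.
  rewrite /E1; case: asboolP => [[SQ _]|nSQ]; first by have [] := hE _ SQ.
  case: (QP m) => [SQ|->]; first by case: nSQ.
  by rewrite !measure0 mule0.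
have E10 i j : i <> j -> mu (E1 i `&` E1 j) = 0%E.
  rewrite /E1 => ij; case: asboolP => [[SQi Qi]|]; last by rewrite set0I measure0.
  case: asboolP => [[SQj Qj]|]; last by rewrite setI0 measure0.
  apply/eqP; rewrite eq_le measure_ge0 andbT.
  rewrite -(Sdisj _ _ SQi SQj) => [|Qij]; last by apply: ij; rewrite -Qi -Qj Qij.
  by apply: leb_le; apply: setISS; [have [] := hE _ SQi|have [] := hE _ SQj].
exists Q, (seqDU E1); split.
- by move=> m; have [[]|] := QP m; [left|right].
- move=> m; split; first exact: seqDU_measurable.
  by apply: subset_trans (E1Q m); exact: subset_seqDU.
- exact: trivIset_seqDU.
- by move=> m; rewrite measure_seqDU_ae.
- exists iota; split => // P SP; rewrite /Q; case: xgetP => [P' _ [SP' PP']|].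
    by apply: iotaI => //; rewrite inE.
  by move=> /(_ P) []; split.
Qed.

End sparse_families.

(** * Symmetric convex bodies and bounded sets of vectors *)
Section bodies.
Context (R : realType) (k : scalar_field) (n : nat).
Local Notation F := (scalarF R k).
Local Notation V := 'rV[F]_n.
Implicit Types u v w a : V.

Lemma sRe_dotvv u : sRe (dot u u) = \sum_j sabs (u 0 j) ^+ 2.
Proof. by rewrite /dot sRe_sum; apply: eq_bigr => j _; rewrite sRe_mul_conj. Qed.

Lemma dotvv_eq0 u : dot u u = 0 -> u = 0.
Proof.
move=> /(congr1 (@sRe R k)); rewrite sRe_dotvv sRe0 => /eqP.
rewrite psumr_eq0 => [/allP u0|j _]; last exact: sqr_ge0.
apply/rowP => j; rewrite mxE; apply: sabs0_eq0; apply/eqP.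
by have := u0 j (mem_index_enum _); rewrite expf_eq0.
Qed.

Lemma dotBl u v w : dot (u - v) w = dot u w - dot v w.
Proof.
by rewrite /dot -sumrB; apply: eq_bigr => j _; rewrite !mxE mulrBl.
Qed.

(** The bipolar theorem for a disc: it exhibits [Kvec u] as an intersection of
    closed sets. *)
Lemma KvecE u : Kvec u = \bigcap_a [set v | sabs (dot a v) <= sabs (dot a u)].
Proof.
apply/seteqP; split => [_ [l /= l1 <-] a _ /=|v h].
  by rewrite sabs_dotZr ler_piMl ?sabs_ge0// -le_norm1.
(* [r] is the component of [v] orthogonal to [u]: testing the hypothesis on [r]
   gives r . v = 0, hence r = 0, and testing it on [u] bounds [l].  When u = 0
   the quotient is 0, so that r = v. *)
pose l := dot v u / dot u u; pose r := v - l *: u.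
have ru : dot r u = 0.
  rewrite /r dotBl dotZl /l.
  have [uu0|uu0] := eqVneq (dot u u) 0; last by rewrite divfK// subrr.
  by rewrite (dotvv_eq0 uu0) !dot0r mulr0 subrr.
have rv : dot r v = 0.
  by apply: sabs0_eq0; apply/eqP; rewrite eq_le sabs_ge0 andbT -(@sabs0 R k) -ru h.
have vE : v = l *: u.
  apply/eqP; rewrite -subr_eq0 -/r; apply/eqP; apply: dotvv_eq0.
  by rewrite {2}/r -scaleNr dotDr dotZr ru rv mulr0 addr0.
exists l => //=; rewrite le_norm1.
have [uu0|uu0] := eqVneq (dot u u) 0; first by rewrite /l uu0 invr0 mulr0 sabs0.
have p0 : 0 < sabs (dot u u).
  by rewrite lt_neqAle sabs_ge0 eq_sym andbT; apply: contra_neq uu0 => /sabs0_eq0.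
have := h u Logic.I; rewrite /= {1}vE sabs_dotZr => hh.
by rewrite -(ler_pM2r p0) mul1r.
Qed.

Lemma Kvec_refl u : Kvec u u.
Proof. by exists 1; rewrite ?scale1r//= normr1. Qed.

Lemma Kvec_trans u v : Kvec u v -> Kvec v `<=` Kvec u.
Proof.
move=> [l /= l1 <-] _ [m /= m1 <-]; exists (m * l); last by rewrite scalerA.
by rewrite /= normrM mulr_ile1.
Qed.

Lemma Kvec_sabs_dot u v a : Kvec u v -> sabs (dot a v) <= sabs (dot a u).
Proof. by rewrite KvecE => /(_ a Logic.I). Qed.

Lemma convex_body_Kvec u : convex_body (Kvec u).
Proof.
split.
- by exists u; exact: Kvec_refl.
- by rewrite KvecE; apply: closed_bigI => a _; exact: closed_sabs_dot.
- move=> _ _ t /set_mem[l /= l1 <-] /set_mem[m /= m1 <-]; apply/mem_set.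
  exists (t%:num * l + (1 - t%:num) * m).
    rewrite /= (le_trans (ler_normD _ _))// !normrM.
    have t0 : 0 <= t%:num :> F by [].
    have t1 : 0 <= 1 - t%:num :> F by rewrite subr_ge0.
    rewrite (ger0_norm t0) (ger0_norm t1).
    apply: (le_trans (lerD (ler_wpM2l t0 l1) (ler_wpM2l t1 m1))).
    by rewrite !mulr1 addrC subrK.
  by rewrite scalerDl -!scalerA.
- move=> l v l1 [m /= m1 <-]; exists (l * m); last by rewrite scalerA.
  by rewrite /= normrM l1 mul1r.
Qed.

Lemma convex_body0 (K : set V) : convex_body K -> K 0.
Proof.
move=> [[u Ku] _ cK sK].
have KNu : K (- u) by rewrite -scaleN1r; apply: sK; rewrite ?normrN1//.
have h0 : 0 <= 2^-1 :> F by rewrite invr_ge0.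
have h1 : 2^-1 <= 1 :> F by rewrite invf_le1// ler1n.
have t : {t : {i01 F} | t%:num = 2^-1}.
  by exists (Itv01 h0 h1).
have : K ((sval t)%:num *: u + (1 - (sval t)%:num) *: (- u)).
  exact: set_mem (cK u (- u) (sval t) (mem_set Ku) (mem_set KNu)).
rewrite (svalP t) scalerN -scalerBl.
rewrite (_ : 2^-1 - (1 - 2^-1) = 0 :> F) ?scale0r//.
by rewrite opprB addrA -[2^-1]mul1r -splitr subrr.
Qed.

(** Some multiple l u with |l| <= 1 meets E: a union over l of preimages of E. *)
Lemma open_Kvec_meets (E : set V) : open E -> open [set u | Kvec u `&` E !=set0].
Proof.
move=> oE.
rewrite (_ : mkset _ = \bigcup_(l in [set l : F | `|l| <= 1]) ((fun u => l *: u) @^-1` E)).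
  apply: bigcup_open => l _; apply: open_comp => // u _; exact: scaler_continuous.
apply/seteqP; split => [u [_ [[l l1 <-] El]]|u [l l1 El]]; first by exists l.
by exists (l *: u); split => //; exists l.
Qed.

Lemma Kvec_measurable d (f : Rd R d -> V) : L0 f -> L0K (fun x => Kvec (f x)).
Proof.
move=> mf; split => [x|E oE]; first exact: convex_body_Kvec.
exact: (borel_fun_preimage mf (open_Kvec_meets oE)).
Qed.

Lemma near_max (T : Type) (A : set T) (h : T -> R) (M : R) : A !=set0 ->
  (forall x, A x -> 0 <= h x <= M) -> exists2 x, A x & forall y, A y -> h y <= 2 * h x.
Proof.
move=> [x0 Ax0] hM; have [h0|hpos] := pselect (forall x, A x -> h x = 0).
  by exists x0 => // y /h0 ->; rewrite h0 ?mulr0.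
have [x1 [Ax1 hx1]] : exists x, A x /\ 0 < h x.
  apply: contrapT => /forallNP no; apply: hpos => x Ax; apply/eqP.
  have /andP[h0 _] := hM _ Ax; rewrite eq_le h0 andbT leNgt.
  by apply/negP => hx; apply: (no x).
have hs : has_sup (h @` A).
  by split; [exists (h x0), x0|exists M => _ [x Ax <-]; have /andP[] := hM _ Ax].
have s0 : 0 < sup (h @` A).
  by apply: lt_le_trans hx1 _; apply: (sup_upper_bound hs); exists x1.
have [_ [x Ax <-] hx] := sup_adherent (divr_gt0 s0 (ltr0Sn R 1)) hs.
exists x => // y Ay.
have : h y <= sup (h @` A) by apply: (sup_upper_bound hs); exists y.
by move: hx; set s := sup _; lra.
Qed.

(** Gaussian elimination with near-maximal pivots.  After m steps, e_0, ...,
    e_(m-1) clear the first m coordinates of every v in K.  The next vector p is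
    chosen so that its remainder has, up to a factor 2, the largest m-th
    coordinate; clearing this coordinate of v then takes a multiple t of the
    remainder of p with |t| <= 2, which turns a bound B on the coefficients into
    B + 2 B. *)
Lemma frame_upto (K : set V) (M : R) : K !=set0 ->
  (forall v j, K v -> sabs (v 0 j) <= M) -> forall m : nat,
  exists e : nat -> V, (forall i, K (e i)) /\ forall v, K v ->
    exists c : nat -> F, (forall i, sabs (c i) <= 3 ^+ m) /\
      forall j : 'I_n, (j < m)%N -> (v - \sum_(i < m) c i *: e i) 0 j = 0.
Proof.
move=> [v0 Kv0] KM; elim=> [|m [e [Ke he]]].
  exists (fun=> v0); split => // v Kv; exists (fun=> 0); split => //.
  by move=> i; rewrite sabs0.
have [c hc] : exists c : V -> nat -> F, forall v, K v ->
    (forall i, sabs (c v i) <= 3 ^+ m) /\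
    forall j : 'I_n, (j < m)%N -> (v - \sum_(i < m) c v i *: e i) 0 j = 0.
  have /choice[c hc] : forall v, exists c : nat -> F, K v ->
    (forall i, sabs (c i) <= 3 ^+ m) /\
    forall j : 'I_n, (j < m)%N -> (v - \sum_(i < m) c i *: e i) 0 j = 0.
    move=> v; have [/he[c ?]|nK] := pselect (K v); first by exists c.
    by exists (fun=> 0).
  by exists c.
pose w v := v - \sum_(i < m) c v i *: e i.
have [mn|nm] := ltnP m n; last first.
  exists e; split => // v Kv; have [c1 c2] := hc _ Kv.
  exists (fun i => if (i < m)%N then c v i else 0); split => [i|j _].
    case: ifP => _; last by rewrite sabs0 exprn_ge0.
    apply: (le_trans (c1 i)); rewrite exprS ler_peMl ?exprn_ge0// ler1n//.
  rewrite big_ord_recr /= ltnn scale0r addr0.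
  rewrite (eq_bigr (fun i : 'I_m => c v i *: e i)); last by move=> i _; rewrite ltn_ord.
  by apply: c2; rewrite (leq_trans (ltn_ord j)).
pose jm := Ordinal mn.
have [p Kp hp] : exists2 p, K p & forall v, K v -> sabs (w v 0 jm) <= 2 * sabs (w p 0 jm).
  apply: (near_max (h := fun v => sabs (w v 0 jm)) (M := M + \sum_(i < m) 3 ^+ m * M)).
    by exists v0.
  move=> v Kv; rewrite sabs_ge0 /= /w !mxE (le_trans (sabsD _ _))// lerD ?KM//.
  rewrite sabsN summxE (le_trans (sabs_sum _ _ _))//; apply: ler_sum => i _.
  rewrite mxE sabsM ler_pM ?sabs_ge0 ?KM//; exact: (hc _ Kv).1.
exists (fun i => if (i < m)%N then e i else p); split => [i|v Kv]; first by case: ifP.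
have [[cv1 cv2] [cp1 cp2]] := (hc _ Kv, hc _ Kp).
(* If the pivot is 0, then so are all m-th coordinates, and t = 0. *)
pose t := w v 0 jm / w p 0 jm.
have t2 : sabs t <= 2.
  rewrite /t sabsM sabsV.
  have [->|p0] := eqVneq (sabs (w p 0 jm)) 0; first by rewrite invr0 mulr0.
  have pp : 0 < sabs (w p 0 jm) by rewrite lt_neqAle eq_sym p0 sabs_ge0.
  by rewrite ler_pdivrMr// hp.
exists (fun i => if (i < m)%N then c v i - t * c p i else t); split => [i|j].
  have e1 : 1 <= 3 ^+ m :> R by rewrite exprn_ege1// ler1n.
  case: ifP => _; last by rewrite exprS (le_trans t2)// -[leLHS]mulr1 ler_pM// ler_nat.
  rewrite (le_trans (sabsD _ _))// sabsN sabsM exprS.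
  have -> : 3 * 3 ^+ m = 3 ^+ m + 2 * 3 ^+ m :> R by ring.
  by rewrite lerD// ler_pM// sabs_ge0.
rewrite ltnS leq_eqVlt big_ord_recr /= ltnn => jm'.
have -> : v - (\sum_(i < m) (if (i < m)%N then c v i - t * c p i else t) *:
    (if (i < m)%N then e i else p) + t *: p) = w v - t *: w p.
  rewrite (eq_bigr (fun i : 'I_m => c v i *: e i - t *: (c p i *: e i))); last first.
    by move=> i _; rewrite ltn_ord scalerBl scalerA.
  rewrite sumrB -scaler_sumr /w scalerBr !opprD !opprK.
  by rewrite -!addrA; congr (_ + _); congr (_ + _); rewrite addrC.
rewrite !mxE.
case/orP: jm' => [/eqP jm'|jm']; last first.
  have := cv2 j jm'; have := cp2 j jm'; rewrite !mxE => -> ->.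
  by rewrite mulr0 subrr.
have -> : j = jm by exact: val_inj.
have := hp v Kv; rewrite /t /w !mxE.
set a := (v 0 jm + _); set b := (p 0 jm + _) => ab.
have [b0|b0] := eqVneq b 0; last by rewrite divfK// subrr.
have a0 : a = 0.
  apply: sabs0_eq0; apply/eqP; rewrite eq_le sabs_ge0 andbT.
  by rewrite (le_trans ab)// b0 sabs0 mulr0.
by rewrite a0 b0 mul0r mulr0 subrr.
Qed.

(** A substitute for an Auerbach basis or the John ellipsoid: the vectors e_i
    belong to K itself, which is what puts them in the maximal function later. *)
Lemma bounded_set_frame (K : set V) (M : R) : K !=set0 ->
  (forall v j, K v -> sabs (v 0 j) <= M) ->
  exists e : 'I_n -> V, (forall i, K (e i)) /\ forall v, K v ->
    exists c : 'I_n -> F, (forall i, sabs (c i) <= 3 ^+ n) /\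
      v = \sum_i c i *: e i.
Proof.
move=> K0 KM; have [e [Ke he]] := frame_upto K0 KM n.
exists (fun i => e i); split => // v /he[c [c1 c2]].
exists (fun i => c i); split => //.
apply/rowP => j; apply/eqP; rewrite -subr_eq0; apply/eqP.
by have := c2 j (ltn_ord j); rewrite !mxE.
Qed.

End bodies.

(** * Averages over cubes *)
Section real_integrals.
Context dd (T : measurableType dd) (R : realType) (mu : {measure set T -> \bar R}).
Implicit Types (Q : set T) (h b : T -> R).

Lemma normr_le_integrable Q h b : measurable Q -> measurable_fun setT h ->
  measurable_fun setT b -> (forall x, 0 <= b x) ->
  (\int[mu]_(x in Q) (b x)%:E < +oo)%E -> {ae mu, forall x, `|h x| <= b x} ->
  mu.-integrable Q (EFin \o h) /\
  `|(\int[mu]_(x in Q) h x)%R| <= fine (\int[mu]_(x in Q) (b x)%:E)%E.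
Proof.
move=> mQ mh mb b0 bQ hb.
have mhQ : measurable_fun Q h by exact: measurable_funTS.
have mbQ : measurable_fun Q b by exact: measurable_funTS.
have hle : (\int[mu]_(x in Q) `|(h x)%:E| <= \int[mu]_(x in Q) (b x)%:E)%E.
  apply: ae_ge0_le_integral => //.
  - by apply: measurableT_comp => //; exact/measurable_EFinP.
  - by move=> x _; rewrite lee_fin.
  - exact/measurable_EFinP.
  - by apply: filterS hb => x hx _; rewrite lee_fin.
have ih : mu.-integrable Q (EFin \o h).
  apply/integrableP; split; first exact/measurable_EFinP.
  exact: le_lt_trans bQ.
split => //; apply: (le_trans (le_normr_Rintegral mQ ih)).
rewrite /Rintegral fine_le//.
  by rewrite ge0_fin_numE; [exact: le_lt_trans bQ|apply: integral_ge0 => x _; rewrite lee_fin].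
by rewrite ge0_fin_numE//; apply: integral_ge0 => x _; rewrite lee_fin.
Qed.

Lemma Rintegral_lincomb Q (I : finType) (c : I -> R) (r : I -> T -> R) : measurable Q ->
  (forall i, mu.-integrable Q (EFin \o r i)) ->
  (\int[mu]_(x in Q) (\sum_i c i * r i x)%:E)%E =
    (\sum_i c i * (\int[mu]_(x in Q) r i x)%R)%:E.
Proof.
move=> mQ ir.
under eq_integral do rewrite -sumEFin.
rewrite integral_sum//; last by move=> i; exact: (integrableZl mQ (c i) (ir i)).
rewrite -sumEFin; apply: eq_bigr => i _.
rewrite (integralZl mQ (ir i)) EFinM fineK//.
exact: (integrable_fin_num mQ (ir i)).
Qed.

Lemma integral_le_restrict Q (f g : T -> R) : measurable Q ->
  measurable_fun setT f -> measurable_fun setT g ->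
  (forall x, 0 <= f x) -> (forall x, 0 <= g x) -> (forall x, Q x -> f x <= g x) ->
  (\int[mu]_(x in Q) (f x)%:E <= \int[mu]_x (g x)%:E)%E.
Proof.
move=> mQ mf mg f0 g0 fg.
apply: (@le_trans _ _ (\int[mu]_(x in Q) (g x)%:E)%E).
  apply: ge0_le_integral => //.
  - by move=> x _; rewrite lee_fin.
  - by apply/measurable_EFinP; exact: measurable_funTS.
  - by apply/measurable_EFinP; exact: measurable_funTS.
apply: ge0_subset_integral => //; first exact/measurable_EFinP.
by move=> x _; rewrite lee_fin.
Qed.

End real_integrals.

Section averages.
Context (R : realType) (k : scalar_field) (d n : nat).
Local Notation F := (scalarF R k).
Local Notation V := 'rV[F]_n.
Local Notation Rd := (Rd R d).
Local Notation mu := (leb R d).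
Implicit Types (f g : Rd -> V) (Q : set Rd).

Lemma sRe_vavg Q f j : sRe (vavg Q f 0 j) =
  (fine (mu Q))^-1 * (\int[mu]_(x in Q) sRe (f x 0 j))%R.
Proof. by rewrite /vavg /rscale !mxE sReM sIm_sC0 mul0r subr0 !sRe_sC. Qed.

Lemma sIm_vavg Q f j : sIm (vavg Q f 0 j) =
  (fine (mu Q))^-1 * (\int[mu]_(x in Q) sIm (f x 0 j))%R.
Proof.
rewrite /vavg /rscale !mxE sImM sIm_sC0 mul0r addr0 sRe_sC; congr (_ * _).
by rewrite /sintegral; case: (k) f => //= f; rewrite /Rintegral integral0.
Qed.

Lemma eq_vavg Q f g : (forall x, Q x -> f x = g x) -> vavg Q f = vavg Q g.
Proof.
move=> fg; apply/rowP => j; apply: scalar_eq; rewrite ?sRe_vavg ?sIm_vavg;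
  congr (_ * _); apply: eq_Rintegral => x /set_mem Qx; by rewrite fg.
Qed.

Definition integrable_on Q f : Prop := (\int[mu]_(x in Q) (vnorm (f x))%:E < +oo)%E.

Lemma vnorm_ge0 (u : V) : 0 <= vnorm u. Proof. exact: sqrtr_ge0. Qed.

Lemma L0_coord_le f (h : Rd -> F) j : {ae mu, forall x, `|h x| <= 1} ->
  {ae mu, forall x, sabs ((h x *: f x) 0 j) <= vnorm (f x)}.
Proof.
apply: filterS => x; rewrite le_norm1 => hx.
rewrite mxE sabsM -[leRHS]mul1r ler_pM ?sabs_ge0//; exact: sabs_le_vnorm.
Qed.

Lemma cavg_bounded Q f : measurable Q -> L0 f -> integrable_on Q f ->
  exists M, forall v j, cavg f Q v -> sabs (v 0 j) <= M.
Proof.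
move=> mQ mf fQ; pose I := fine (\int[mu]_(x in Q) (vnorm (f x))%:E)%E.
exists ((fine (mu Q))^-1 * I + (fine (mu Q))^-1 * I) => _ j [h [/borel_fun_smeasurable mh h1] <-].
have m0 : 0 <= (fine (mu Q))^-1 by rewrite invr_ge0 fine_ge0.
have mhf := L0_scale mh mf; have hle := L0_coord_le f j h1.
apply: (le_trans (sabs_le_reim _)); rewrite sRe_vavg sIm_vavg !normrM (ger0_norm m0).
have v0 x : 0 <= vnorm (f x) by exact: vnorm_ge0.
have hr' : {ae mu, forall x, `|sRe ((h x *: f x) 0 j)| <= vnorm (f x)}.
  by apply: filterS hle => x; apply: le_trans; exact: sRe_le_sabs.
have hi' : {ae mu, forall x, `|sIm ((h x *: f x) 0 j)| <= vnorm (f x)}.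
  by apply: filterS hle => x; apply: le_trans; exact: sIm_le_sabs.
have mv := measurable_vnorm mf.
have [_ l1] := normr_le_integrable mQ (L0_sRe j mhf) mv v0 fQ hr'.
have [_ l2] := normr_le_integrable mQ (L0_sIm j mhf) mv v0 fQ hi'.
exact: lerD (ler_wpM2l m0 l1) (ler_wpM2l m0 l2).
Qed.

Lemma cavg_nonempty Q f : cavg f Q !=set0.
Proof.
exists (vavg Q (fun x => 0 *: f x)); exists (fun=> 0) => //; split.
  apply: borel_fun_opens => U oU.
  have [U0|U0] := pselect (U 0).
    by rewrite (_ : _ @^-1` _ = setT); [exact: measurableT|apply/seteqP; split].
  by rewrite (_ : _ @^-1` _ = set0); [exact: measurable0|apply/seteqP; split].
by apply: aeW => x; rewrite normr0.
Qed.

Lemma smeasurable_cutoff Q (h : Rd -> F) : measurable Q -> smeasurable h ->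
  smeasurable (fun x => sC k (\1_Q x) 0 * h x).
Proof. by move=> mQ; apply: smeasurable_real; exact: measurable_indic. Qed.

(** The factor 1_Q h keeps h f in K(f) on Q and kills it elsewhere. *)
Lemma S0_cutoff Q f (h : Rd -> F) : measurable Q -> L0 f -> smeasurable h ->
  {ae mu, forall x, `|h x| <= 1} ->
  S0 (Krestrict Q (fun x => Kvec (f x))) (fun x => (sC k (\1_Q x) 0 * h x) *: f x).
Proof.
move=> mQ mf mh h1; split; first exact: L0_scale (smeasurable_cutoff mQ mh) mf.
apply: filterS h1 => x hx; rewrite /Krestrict; case: asboolP => Qx.
  by exists (h x) => //; rewrite indicE mem_set//= sC1 mul1r.
by rewrite indicE memNset//= sC0 mul0r scale0r.
Qed.

Lemma Kavg_Kvec Q f (h : Rd -> F) : measurable Q -> L0 f -> smeasurable h ->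
  {ae mu, forall x, `|h x| <= 1} ->
  Kavg (fun x => Kvec (f x)) Q (vavg Q (fun x => h x *: f x)).
Proof.
move=> mQ mf mh h1; exists (fun x => (sC k (\1_Q x) 0 * h x) *: f x).
  exact: S0_cutoff.
by apply: eq_vavg => x Qx; rewrite indicE mem_set//= sC1 mul1r.
Qed.

Lemma cavg_sub_Kavg Q f : measurable Q -> L0 f ->
  cavg f Q `<=` Kavg (fun x => Kvec (f x)) Q.
Proof.
by move=> mQ mf _ [h [/borel_fun_smeasurable mh h1] <-]; exact: Kavg_Kvec.
Qed.

Lemma Kavg_sub_MK (G : Rd -> set V) Q x : cube Q -> Q x -> Kavg G Q `<=` MK G x.
Proof. by move=> cQ Qx v Gv K Kb UK; apply: UK; exists Q. Qed.

Lemma MK0 (G : Rd -> set V) x : MK G x 0.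
Proof. by move=> K Kb _; exact: convex_body0. Qed.

Lemma L1locK_integrable_on Q f : L0 f -> L1locK (fun x => Kvec (f x)) -> cube Q ->
  integrable_on Q f.
Proof.
move=> mf [_ /(_ Q)] /[swap] cQ /(_ cQ)[M hM].
have [mQ _] := cubeP cQ.
have c3 : {ae mu, forall x : Rd, `|1 : F| <= 1} by apply: aeW => x; rewrite normr1.
have m1 := smeasurable_cst d (1 : F).
have := hM _ (S0_cutoff mQ mf m1 c3) => h.
rewrite /integrable_on; apply: (@le_lt_trans _ _ M%:E); last exact: ltry.
apply: le_trans h.
have v0 g x : 0 <= vnorm (g x : V) by exact: vnorm_ge0.
apply: (integral_le_restrict mu mQ (measurable_vnorm mf)
  (measurable_vnorm (L0_scale (smeasurable_cutoff mQ m1) mf)) (v0 _) (v0 _)).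
by move=> x Qx; rewrite indicE mem_set// mulr1 sC1 scale1r.
Qed.

(** Take w to be the average of s g, where the phase s of e . g makes
    e . (s g) = |e . g|; then the real part of e . w is the average of |e . g|. *)
Lemma Kavg_aligned Q g (e : V) : measurable Q -> (mu Q < +oo)%E -> L0 g -> integrable_on Q g ->
  exists2 w, Kavg (fun x => Kvec (g x)) Q w &
    (\int[mu]_(x in Q) (sabs (dot e (g x)))%:E <= mu Q * (sabs (dot e w))%:E)%E.
Proof.
move=> mQ Qoo mg gQ.
pose z x := dot e (g x); pose s x : F := sC k (sabs (z x))^-1 0 * z x.
have mz : smeasurable z := smeasurable_dot (L0_cst e) mg.
have ms : smeasurable s.
  apply: (smeasurable_real _ mz); under eq_fun do rewrite -powR_inv1 ?sabs_ge0//.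
  exact: (measurableT_comp (measurable_powR (-1)) (smeasurable_sabs mz)).
have s1 x : sabs (s x) <= 1.
  rewrite sabsM sabs_sC ger0_norm ?invr_ge0 ?sabs_ge0//.
  have [->|z0] := eqVneq (sabs (z x)) 0; first by rewrite mulr0.
  by rewrite mulVf.
have s1ae : {ae mu, forall x, `|s x| <= 1} by apply: aeW => x; rewrite le_norm1.
exists (vavg Q (fun x => s x *: g x)); first exact: Kavg_Kvec.
have msg : L0 (fun x => s x *: g x) by exact: (L0_scale ms mg).
have zE x : sabs (z x) = sRe (dot e (s x *: g x)).
  rewrite dotZr -/(z x) /s sconjM sReM.
  have -> : sconj (sC k (sabs (z x))^-1 0) = sC k (sabs (z x))^-1 0 :> F.
    by apply: scalar_eq; rewrite ?sRe_conj ?sIm_conj ?sIm_sC0 ?oppr0.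
  rewrite sReM sImM !sRe_sC !sIm_sC0 sRe_conj sIm_conj !mul0r subr0 addr0.
  have -> : (sabs (z x))^-1 * sRe (z x) * sRe (z x) -
    (sabs (z x))^-1 * - sIm (z x) * sIm (z x) =
    (sRe (z x) ^+ 2 + sIm (z x) ^+ 2) * (sabs (z x))^-1 by ring.
  rewrite -[X in X * _]sqr_sqrtr; last by rewrite addr_ge0 ?sqr_ge0.
  rewrite -sabsE; have [->|z0] := eqVneq (sabs (z x)) 0; first by rewrite invr0 mulr0.
  by rewrite expr2 mulfK.
have bnd j x : sabs ((s x *: g x) 0 j) <= vnorm (g x).
  by rewrite mxE sabsM -[leRHS]mul1r ler_pM ?sabs_ge0//; exact: sabs_le_vnorm.
have v0 x : 0 <= vnorm (g x) by exact: vnorm_ge0.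
have mv := measurable_vnorm mg.
(* Re (e . u) is a real linear combination of the real and imaginary parts of the
   coordinates of u, so it commutes with the integral. *)
pose r (p : 'I_n * bool) x := if p.2 then sRe ((s x *: g x) 0 p.1) else sIm ((s x *: g x) 0 p.1).
pose c (p : 'I_n * bool) := if p.2 then sRe (e 0 p.1) else sIm (e 0 p.1).
have ir p : mu.-integrable Q (EFin \o r p).
  have mr : measurable_fun setT (r p).
    by rewrite /r; case: p.2; [exact: L0_sRe|exact: L0_sIm].
  have hr : {ae mu, forall x, `|r p x| <= vnorm (g x)}.
    apply: aeW => x; apply: le_trans (bnd p.1 x); rewrite /r.
    by case: p.2; [exact: sRe_le_sabs|exact: sIm_le_sabs].
  by have [] := normr_le_integrable mQ mr mv v0 gQ hr.
have sum2 (h : 'I_n * bool -> R) : \sum_p h p = \sum_j (h (j, true) + h (j, false)).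
  rewrite (eq_bigr (fun p => h (p.1, p.2))); last by case.
  rewrite -(pair_bigA _ (fun j b => h (j, b))) /=; apply: eq_bigr => j _.
  by rewrite big_bool.
have izE : (\int[mu]_(x in Q) (sabs (z x))%:E)%E =
    (\sum_p c p * (\int[mu]_(x in Q) r p x)%R)%:E.
  rewrite -(Rintegral_lincomb c mQ ir); apply: eq_integral => x _.
  by rewrite zE sRe_dot sum2.
have [Q0|Q0] := eqVneq (fine (mu Q)) 0.
  have muQ0 : mu Q = 0%E by apply/eqP; rewrite -fine_eq0 ?Q0// ge0_fin_numE.
  have mzQ : measurable_fun Q (fun x => (sabs (z x))%:E).
    by apply/measurable_EFinP; apply: measurable_funTS; exact: (smeasurable_sabs mz).
  by rewrite (null_set_integral mQ mzQ muQ0) muQ0 mul0e.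
have -> : mu Q = (fine (mu Q))%:E by rewrite fineK// ge0_fin_numE.
rewrite izE -EFinM lee_fin.
have -> : \sum_p c p * (\int[mu]_(x in Q) r p x)%R =
    fine (mu Q) * sRe (dot e (vavg Q (fun x => s x *: g x))).
  rewrite sum2 sRe_dot mulr_sumr; apply: eq_bigr => j _.
  by rewrite sRe_vavg sIm_vavg mulrDr; congr (_ + _); rewrite mulrCA mulVKf.
by rewrite ler_wpM2l ?fine_ge0// (le_trans (ler_norm _))// sRe_le_sabs.
Qed.

End averages.

(** * Koethe duality and bounded maximal operators *)
Section function_spaces.
Context (R : realType) (k : scalar_field) (d n : nat).
Local Notation F := (scalarF R k).
Local Notation V := 'rV[F]_n.
Local Notation Rd := (Rd R d).
Local Notation mu := (leb R d).
Implicit Types (X : fspace R k d n) (f g : Rd -> V) (C : R).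

(** The part of the axioms of a directional Banach function space that the
    maximal operator uses; unlike the full list, it is immediate for a Koethe
    dual. *)
Record ideal_space X : Prop := {
  ideal_L0 : elt X `<=` @L0 R k d n;
  ideal_ge0 : forall f, elt X f -> 0 <= fnorm X f;
  ideal_le : forall f g, elt X f -> L0 g ->
    {ae mu, forall x, Kvec (g x) `<=` Kvec (f x)} ->
    elt X g /\ fnorm X g <= fnorm X f }.

Lemma dirBFS_ideal_space X : dirBFS X -> ideal_space X.
Proof. by case. Qed.

Lemma fine_le_Ny_or_ge0 (x y : \bar R) : (x <= y)%E -> (y < +oo)%E ->
  (x = -oo%E \/ 0 <= x)%E -> (y = -oo%E \/ 0 <= y)%E -> fine x <= fine y.
Proof.
move=> xy yoo [->|x0] [y0|y0]; rewrite ?y0//=; first exact: fine_ge0.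
  by move: xy; rewrite y0 leeNy_eq => /eqP ->.
by rewrite fine_le// ge0_fin_numE// (le_lt_trans xy).
Qed.

(** The supremum of the empty set is -oo, and its [fine] part is 0. *)
Lemma kothe_norm_Ny_or_ge0 X g : (kothe_norm X g = -oo \/ 0 <= kothe_norm X g)%E.
Proof.
rewrite /kothe_norm; set A := [set _ | _ in _].
have [[y Ay]|nA] := pselect (A !=set0).
  right; apply: (@le_trans _ _ y); last exact: ereal_sup_ubound.
  by case: Ay => f _ <-; apply: integral_ge0 => x _; rewrite lee_fin sabs_ge0.
left; rewrite (_ : A = set0) ?ereal_sup0//.
by apply/eqP; apply/negP => /negP/set0P.
Qed.

Lemma fnorm_kothe_dual_ge0 X g : 0 <= fnorm (kothe_dual X) g.
Proof. by rewrite /=; case: (kothe_norm_Ny_or_ge0 X g) => [->|/fine_ge0]. Qed.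

Lemma measurable_sabs_dotE f g : L0 f -> L0 g ->
  measurable_fun setT (fun x => (sabs (dot (f x) (g x)))%:E).
Proof. by move=> mf mg; apply/measurable_EFinP; exact: measurable_sabs_dot. Qed.

Lemma kothe_dual_ideal_space X : elt X `<=` @L0 R k d n -> ideal_space (kothe_dual X).
Proof.
move=> XL0; split => [f []//|f _|g g' [mg goo] mg' gg']; first exact: fnorm_kothe_dual_ge0.
have le : (kothe_norm X g' <= kothe_norm X g)%E.
  apply: ub_ereal_sup => _ [f [Xf f1] <-].
  apply: (@le_trans _ _ (\int[mu]_x (sabs (dot (f x) (g x)))%:E)%E); last first.
    by apply: ereal_sup_ubound; exists f.
  have mf := XL0 _ Xf.
  apply: (ae_ge0_le_integral measurableT) (measurable_sabs_dotE mf mg') _ (measurable_sabs_dotE mf mg) _.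
  - by move=> x _; rewrite lee_fin sabs_ge0.
  - by move=> x _; rewrite lee_fin sabs_ge0.
  - apply: filterS gg' => x gg'x _; rewrite lee_fin; apply: Kvec_sabs_dot.
    exact/gg'x/Kvec_refl.
have g'oo := le_lt_trans le goo.
split; first by split.
exact: fine_le_Ny_or_ge0 le goo (kothe_norm_Ny_or_ge0 _ _) (kothe_norm_Ny_or_ge0 _ _).
Qed.

Lemma kothe_holder X f g : dirBFS X -> elt X f -> elt (kothe_dual X) g ->
  (\int[mu]_x (sabs (dot (f x) (g x)))%:E <=
     (fnorm X f * fnorm (kothe_dual X) g)%:E)%E.
Proof.
move=> HX Xf [mg goo]; have mf := dirBFS_L0 HX Xf.
have f0 := dirBFS_ge0 HX Xf.
have [fn0|fn0] := eqVneq (fnorm X f) 0.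
  have := dirBFS_eq0 HX Xf fn0 => f00.
  have le0 : (\int[mu]_x (sabs (dot (f x) (g x)))%:E <= \int[mu]_(x in setT) (cst 0%E) x)%E.
    apply: (ae_ge0_le_integral measurableT) (measurable_sabs_dotE mf mg) _ (measurable_cst _) _.
    - by move=> x _; rewrite lee_fin sabs_ge0.
    - by [].
    - by apply: filterS f00 => x -> _; rewrite dot0l sabs0.
  by apply: (le_trans le0); rewrite integral0 fn0 mul0r.
have fpos : 0 < fnorm X f by rewrite lt_neqAle eq_sym fn0.
pose c := (fnorm X f)^-1.
have c0 : 0 <= c by rewrite invr_ge0.
have [Xcf ncf] := dirBFS_scale HX (sC k c 0) Xf.
have ncf1 : fnorm X (fun x => sC k c 0 *: f x) = 1.
  by rewrite ncf sabs_sC ger0_norm// mulVf.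
have leS : (\int[mu]_x (sabs (dot (sC k c 0 *: f x) (g x)))%:E <= kothe_norm X g)%E.
  by apply: ereal_sup_ubound; exists (fun x => sC k c 0 *: f x).
have kg0 : (0 <= kothe_norm X g)%E.
  by apply: le_trans leS; apply: integral_ge0 => x _; rewrite lee_fin sabs_ge0.
have -> : (\int[mu]_x (sabs (dot (f x) (g x)))%:E =
    (fnorm X f)%:E * \int[mu]_x (sabs (dot (sC k c 0 *: f x) (g x)))%:E)%E.
  have mcf := measurable_sabs_dotE (dirBFS_L0 HX Xcf) mg.
  have p0 x : setT x -> (0 <= (sabs (dot (sC k c 0 *: f x) (g x)))%:E)%E.
    by move=> _; rewrite lee_fin sabs_ge0.
  rewrite -(ge0_integralZl_EFin mu measurableT p0 mcf f0).
  apply: eq_integral => x _; rewrite dotZl sabsM sabs_sC ger0_norm// -EFinM.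
  by rewrite mulVKf.
rewrite EFinM lee_wpmul2l// ?lee_fin//.
by rewrite /= fineK// ge0_fin_numE.
Qed.

Lemma XKnorm_ge0 X (G : Rd -> set V) : (forall f, elt X f -> 0 <= fnorm X f) ->
  XK X G -> 0 <= XKnorm X G.
Proof.
move=> X0 [_ GX [M GM]]; rewrite /XKnorm; set A := [set _ | _ in _].
have [[y Ay]|nA] := pselect (A !=set0).
  apply: (@le_trans _ _ y); first by case: Ay => f /GX/X0 ? <-.
  apply: ub_le_sup => //; exists M => _ [f Gf <-]; exact: GM.
by rewrite (_ : A = set0) ?sup0//; apply/eqP; apply/negP => /negP/set0P.
Qed.

(** The infimum of the admissible constants is attained, because the inequality is
    closed in the constant. *)
Lemma MK_bound_opnorm X : (forall f, elt X f -> 0 <= fnorm X f) ->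
  MK_bounded X -> MK_bound X (MK_opnorm X).
Proof.
move=> X0 [C0 HC0]; have [C00 XL _] := HC0.
have ne : [set C | MK_bound X C] !=set0 by exists C0.
split => //; first by apply: lb_le_inf => // C [].
move=> G XG; have [_ _ /(_ G XG)[XMG leC0]] := HC0; split => //.
have := XKnorm_ge0 X0 XG; rewrite le_eqVlt => /predU1P[G0|Gpos].
  by move: leC0; rewrite -G0 !mulr0.
rewrite -ler_pdivrMr//; apply: lb_le_inf => // C [_ _ /(_ G XG)[_ leC]].
by rewrite ler_pdivrMr.
Qed.

Lemma XK_Kvec X f : ideal_space X -> elt X f ->
  XK X (fun x => Kvec (f x)) /\ XKnorm X (fun x => Kvec (f x)) <= fnorm X f.
Proof.
move=> HX Xf; have mf := ideal_L0 HX Xf.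
have h g : S0 (fun x => Kvec (f x)) g -> elt X g /\ fnorm X g <= fnorm X f.
  move=> [mg gf]; apply: (ideal_le HX) => //.
  by apply: filterS gf => x; exact: Kvec_trans.
split; first split.
- exact: Kvec_measurable.
- by move=> g /h[].
- by exists (fnorm X f) => g /h[].
apply: ge_sup => [|_ [g /h[_ ?] <-]//].
by exists (fnorm X f), f => //; split => //; apply: aeW => x; exact: Kvec_refl.
Qed.

(** How the boundedness of M^K is used: every measurable selection of M^K(K(f))
    is in the space, with norm controlled by that of f. *)
Lemma MK_selection X C f F : ideal_space X -> MK_bound X C -> elt X f -> L0 F ->
  (forall x, MK (fun x => Kvec (f x)) x (F x)) ->
  elt X F /\ fnorm X F <= C * fnorm X f.
Proof.
move=> HX [C0 _ HC] Xf mF FM; have [XG Gle] := XK_Kvec HX Xf.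
have [[_ MX [M MM]] Mle] := HC _ XG.
have SF : S0 (MK (fun x => Kvec (f x))) F by split => //; exact: aeW.
split; first exact: MX.
apply: (le_trans _ (le_trans Mle (ler_wpM2l C0 Gle))).
by apply: ub_le_sup; [exists M => _ [g Sg <-]; exact: MM|exists F].
Qed.

Lemma MK_bound_integrable_on X C f Q : ideal_space X -> MK_bound X C -> elt X f ->
  cube Q -> integrable_on Q f.
Proof.
move=> HX [_ XL _] Xf; apply: L1locK_integrable_on; first exact: (ideal_L0 HX).
by apply: XL; have [] := XK_Kvec HX Xf.
Qed.

Lemma step_function (E : (set Rd)^nat) (v : nat -> V) :
  (forall m, measurable (E m)) -> trivIset setT E ->
  exists F, [/\ L0 F, forall m x, E m x -> F x = v m &
                forall x, (forall m, ~ E m x) -> F x = 0].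
Proof.
move=> mE tE.
pose F x := if pselect (exists m, E m x) is left h then v (projT1 (cid h)) else 0.
have FE m x : E m x -> F x = v m.
  rewrite /F => Ex; case: pselect => [h|[]]; last by exists m.
  have Eh := projT2 (cid h); set m' := projT1 _ in Eh *.
  by have := tE m' m Logic.I Logic.I; rewrite (_ : m' = m) //; apply: (tE m' m) => //; exists x.
have F0 x : (forall m, ~ E m x) -> F x = 0.
  by rewrite /F => no; case: pselect => // -[m Em]; case: (no m).
exists F; split => //; apply: borel_fun_opens => U oU.
rewrite (_ : F @^-1` U = (\bigcup_(m in [set m | U (v m)]) E m) `|`
    (if `[< U 0 >] then ~` (\bigcup_m E m) else set0)).
  apply: measurableU; first by apply: bigcup_measurable => m _; exact: mE.
  case: ifP => _; last exact: measurable0.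
  by apply: measurableC; apply: bigcupT_measurable; exact: mE.
apply/seteqP; split => x.
  rewrite /preimage /= => UFx; have [[m Em]|no] := pselect (exists m, E m x).
    by left; exists m => //=; rewrite -(FE m x).
  right; have nE m : ~ E m x by move=> Em; apply: no; exists m.
  rewrite F0// in UFx; case: asboolP => // _ [m _ Em]; exact: (nE m).
case => [[m /= Uv Em]|]; first by rewrite /preimage /= (FE m x).
case: asboolP => // U0 nE; rewrite /preimage /= F0// => m Em; apply: nE.
by exists m.
Qed.

(** One scalar sparse form.  With w_m given by [Kavg_aligned], the m-th integral is
    at most 4 |E_m| |e_m . w_m|, which is 4 times the integral over E_m of |F . G|
    for the step functions F and G with values e_m and w_m on E_m. *)
Lemma sparse_form_le X C C' f g (Q E : (set Rd)^nat) (e : nat -> V) :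
  dirBFS X -> MK_bound X C -> MK_bound (kothe_dual X) C' ->
  elt X f -> elt (kothe_dual X) g ->
  (forall m, cube (Q m) \/ Q m = set0) ->
  (forall m, measurable (E m) /\ E m `<=` Q m) -> trivIset setT E ->
  (forall m, (mu (Q m) <= 4%:E * mu (E m))%E) ->
  (forall m, cavg f (Q m) (e m)) ->
  (\sum_(m <oo) \int[mu]_(x in Q m) (sabs (dot (e m) (g x)))%:E <=
    (4 * (C * fnorm X f) * (C' * fnorm (kothe_dual X) g))%:E)%E.
Proof.
move=> HX HC HC' Xf Xg cQ mE tE QE eQ.
have IX := dirBFS_ideal_space HX.
have IX' := kothe_dual_ideal_space (dirBFS_L0 HX).
have mf := ideal_L0 IX Xf; have mg := ideal_L0 IX' Xg.
have mQ m : measurable (Q m).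
  by case: (cQ m) => [/cubeP[]//|->]; exact: measurable0.
have Qoo m : (mu (Q m) < +oo)%E.
  by case: (cQ m) => [/cubeP[_ /andP[]]//|->]; rewrite measure0 ltry.
have gQ m : integrable_on (Q m) g.
  case: (cQ m) => [|->]; first exact: (MK_bound_integrable_on IX' HC' Xg).
  by rewrite /integrable_on integral_set0 ltry.
have /choice[w hw] m : exists w, Kavg (fun x => Kvec (g x)) (Q m) w /\
    (\int[mu]_(x in Q m) (sabs (dot (e m) (g x)))%:E <=
      mu (Q m) * (sabs (dot (e m) w))%:E)%E.
  by have [w w1 w2] := Kavg_aligned (e m) (mQ m) (Qoo m) mg (gQ m); exists w.
have mE1 m : measurable (E m) by have [] := mE m.
have [F [mF FE F0]] := step_function e mE1 tE.
have [G [mG GE G0]] := step_function w mE1 tE.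
have cub m x : E m x -> cube (Q m).
  by have [_ EQ] := mE m => /EQ; case: (cQ m) => // ->.
have FM x : MK (fun x => Kvec (f x)) x (F x).
  have [[m Em]|no] := pselect (exists m, E m x); last first.
    by rewrite F0; [exact: MK0|move=> m Em; apply: no; exists m].
  have [_ EQ] := mE m.
  rewrite (FE m)//; apply: (Kavg_sub_MK (cub _ _ Em) (EQ _ Em)).
  exact: cavg_sub_Kavg.
have GM x : MK (fun x => Kvec (g x)) x (G x).
  have [[m Em]|no] := pselect (exists m, E m x); last first.
    by rewrite G0; [exact: MK0|move=> m Em; apply: no; exists m].
  have [_ EQ] := mE m.
  rewrite (GE m)//; apply: (Kavg_sub_MK (cub _ _ Em) (EQ _ Em)).
  by have [] := hw m.
have [XF nF] := MK_selection IX HC Xf mF FM.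
have [XG nG] := MK_selection IX' HC' Xg mG GM.
have term m : (\int[mu]_(x in Q m) (sabs (dot (e m) (g x)))%:E <=
    4%:E * \int[mu]_(x in E m) (sabs (dot (F x) (G x)))%:E)%E.
  have -> : (\int[mu]_(x in E m) (sabs (dot (F x) (G x)))%:E =
      \int[mu]_(x in E m) (sabs (dot (e m) (w m)))%:E)%E.
    by apply: eq_integral => x /set_mem Ex; rewrite (FE m)// (GE m).
  have [_ le] := hw m; apply: (le_trans le).
  rewrite integral_cst// [X in (_ <= 4%:E * X)%E]muleC muleA.
  by apply: lee_wpmul2r; [rewrite lee_fin sabs_ge0|exact: QE].
apply: (@le_trans _ _ (\sum_(m <oo) (4%:E * \int[mu]_(x in E m) (sabs (dot (F x) (G x)))%:E))%E).
  apply: lee_nneseries => [m _ _|m _]; last exact: term.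
  by apply: integral_ge0 => x _; rewrite lee_fin sabs_ge0.
rewrite nneseriesZl; last first.
  by move=> m _; apply: integral_ge0 => x _; rewrite lee_fin sabs_ge0.
have mFG := measurable_sabs_dotE mF mG.
rewrite -(ge0_integral_bigcup mu mE1 _ _ tE); last 2 first.
- by apply: measurable_funTS mFG.
- by move=> x _; rewrite lee_fin sabs_ge0.
rewrite -mulrA EFinM lee_wpmul2l//.
apply: (@le_trans _ _ (\int[mu]_x (sabs (dot (F x) (G x)))%:E)%E).
  have mU : measurable (\bigcup_m E m) by exact: bigcupT_measurable.
  apply: (ge0_subset_integral mu mU measurableT mFG); last exact: subsetT.
  by move=> x _; rewrite lee_fin sabs_ge0.
apply: (le_trans (kothe_holder HX XF XG)); rewrite lee_fin.
by apply: ler_pM => //; [exact: (dirBFS_ge0 HX)|exact: fnorm_kothe_dual_ge0].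
Qed.

End function_spaces.

(** * From set-valued sparse sums to scalar ones *)
Section pointwise_domination.
Context (R : realType) (k : scalar_field) (n : nat).
Local Notation F := (scalarF R k).
Local Notation V := 'rV[F]_n.

Lemma minkowski_sabs_dot (I : eqType) (a : V) (A : I -> set V) (b : I -> R) (s : seq I) :
  (forall i w, i \in s -> A i w -> sabs (dot a w) <= b i) ->
  forall w, (\big[@Defs.minkowski R k n/[set 0]]_(i <- s) A i) w ->
  sabs (dot a w) <= \sum_(i <- s) b i.
Proof.
elim: s => [|i s IH] Ab w; first by rewrite !big_nil => ->; rewrite dot0r sabs0.
rewrite !big_cons; apply: closure_sabs_dot => _ [u [v [Au sv ->]]].
rewrite dotDr (le_trans (sabsD _ _))// lerD//; first by apply: Ab; rewrite ?mem_head.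
by apply: IH => // j v' js; apply: Ab; rewrite in_cons js orbT.
Qed.

Lemma sum_uniq_le_nneseries (b : nat -> \bar R) (s : seq nat) : uniq s ->
  (forall m, 0 <= b m)%E -> (\sum_(m <- s) b m <= \sum_(m <oo) b m)%E.
Proof.
move=> us b0; pose N := (\max_(m <- s) m).+1.
apply: (@le_trans _ _ (\sum_(0 <= m < N) b m)%E); last exact: nneseries_lim_ge.
rewrite [leRHS](bigID (fun m => m \in s)) /=.
rewrite (_ : \sum_(m <- s) b m = \sum_(0 <= m < N | m \in s) b m)%E; last first.
  rewrite -[RHS]big_filter (perm_big [seq m <- index_iota 0 N | m \in s])//.
  apply: uniq_perm => //; first by rewrite filter_uniq// iota_uniq.
  move=> m; rewrite mem_filter mem_index_iota leq0n /= ltnS.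
  case: (boolP (m \in s)) => //= ms.
  by have -> : (m <= \max_(i <- s) i)%N by exact: (leq_bigmax_seq (F := fun i : nat => i) m).
by rewrite leeDl// sume_ge0.
Qed.

(** A bound on |a . w| for w in each term bounds it on finite Minkowski sums and on
    the closure of their union; the index map [iota] turns the sum over S into a
    series. *)
Lemma setsum_sabs_dot (I : eqType) (S : set I) (a : V) (A : I -> set V)
    (iota : I -> nat) (b : nat -> R) :
  {in S &, injective iota} -> (forall m, 0 <= b m) ->
  (forall i w, S i -> A i w -> sabs (dot a w) <= b (iota i)) ->
  forall w, setsum S A w -> ((sabs (dot a w))%:E <= \sum_(m <oo) (b m)%:E)%E.
Proof.
move=> iotaI b0 Ab w Sw.
have B0 : (0 <= \sum_(m <oo) (b m)%:E)%E by apply: nneseries_ge0 => m _ _; rewrite lee_fin.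
have [->|Boo] := eqVneq (\sum_(m <oo) (b m)%:E)%E +oo%E; first exact: leey.
have Bfin : (\sum_(m <oo) (b m)%:E)%E \is a fin_num by rewrite ge0_fin_numE// ltey.
rewrite -(fineK Bfin) lee_fin; apply: closure_sabs_dot Sw => {}w [s [us sS] sw].
rewrite -lee_fin fineK//.
have h : ((sabs (dot a w))%:E <= (\sum_(i <- s) b (iota i))%:E)%E.
  by rewrite lee_fin; apply: (minkowski_sabs_dot _ sw) => i v /sS; exact: Ab.
apply: (le_trans h); rewrite -sumEFin -(big_map iota xpredT (fun m => (b m)%:E)).
apply: sum_uniq_le_nneseries => [|m]; last by rewrite lee_fin.
rewrite map_inj_in_uniq// => i j /sS Si /sS Sj; apply: iotaI; exact: mem_set.
Qed.

End pointwise_domination.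

Section weighted_integral.
Context dd (T : measurableType dd) (R : realType) (mu : {measure set T -> \bar R}).

Lemma integral_mul_indic (Q : set T) (f : T -> R) :
  (\int[mu]_x (f x * \1_Q x)%:E = \int[mu]_(x in Q) (f x)%:E)%E.
Proof.
rewrite [RHS]integral_mkcond; apply: eq_integral => x _.
by rewrite patchE indicE; case: (x \in Q); rewrite ?mulr1 ?mulr0.
Qed.

Lemma ge0_integral_lincomb (I : finType) (c : R) (t : I -> T -> R) : 0 <= c ->
  (forall i, measurable_fun setT (t i)) -> (forall i x, 0 <= t i x) ->
  (\int[mu]_x (c * \sum_i t i x)%:E = \sum_i c%:E * \int[mu]_x (t i x)%:E)%E.
Proof.
move=> c0 mt t0.
under eq_integral do rewrite EFinM -sumEFin.
rewrite ge0_integralZl_EFin//; last 2 first.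
- by move=> x _; apply: sume_ge0 => i _; rewrite lee_fin.
- by apply: emeasurable_sum => i; exact/measurable_EFinP.
rewrite ge0_integral_sum//; last 2 first.
- by move=> i; exact/measurable_EFinP.
- by move=> i x _; rewrite lee_fin.
by rewrite ge0_sume_distrr// => i _; apply: integral_ge0 => x _; rewrite lee_fin.
Qed.

End weighted_integral.

Section sparse_domination.
Context (R : realType) (k : scalar_field) (d n : nat).
Local Notation F := (scalarF R k).
Local Notation V := 'rV[F]_n.
Local Notation Rd := (Rd R d).
Local Notation mu := (leb R d).
Implicit Types (X : fspace R k d n).

(** The heart of the theorem: the integral of |g . h| for an h dominated by the
    sparse sum of the averages of f. *)
Lemma sparse_pairing_le X C C' (S : set (set Rd)) (CT : R) (f g h : Rd -> V) :
  dirBFS X -> MK_bound X C -> MK_bound (kothe_dual X) C' ->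
  sparse S -> 0 <= CT -> elt X f -> elt (kothe_dual X) g -> L0 h ->
  {ae mu, forall x, exists2 u : V,
     setsum S (fun Q => Krestrict Q (fun=> cavg f Q) x) u & h x = rscale CT u} ->
  (\int[mu]_x (sabs (dot (g x) (h x)))%:E <=
    (n%:R * 3 ^+ n * 4 * CT * C * C' * fnorm X f * fnorm (kothe_dual X) g)%:E)%E.
Proof.
move=> HX HC HC' spS CT0 Xf Xg mh hdom.
have IX := dirBFS_ideal_space HX.
have mf := ideal_L0 IX Xf; have mg : L0 g by case: Xg.
have [Q [E [QS mE tE QE [iota [iotaI iotaK]]]]] := sparse_sequence spS.
have [Scube _ _] := spS.
have cQ m : cube (Q m) \/ Q m = set0.
  by case: (QS m) => [/Scube|]; [left|right].
have mQ m : measurable (Q m).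
  by case: (cQ m) => [/cubeP[]//|->]; exact: measurable0.
have fQ m : integrable_on (Q m) f.
  case: (cQ m) => [|->]; first exact: (MK_bound_integrable_on IX HC Xf).
  by rewrite /integrable_on integral_set0 ltry.
have /choice[e he] m : exists e : 'I_n -> V, (forall i, cavg f (Q m) (e i)) /\
    forall v, cavg f (Q m) v -> exists c : 'I_n -> F,
      (forall i, sabs (c i) <= 3 ^+ n) /\ v = \sum_i c i *: e i.
  have [M hM] := cavg_bounded (mQ m) mf (fQ m).
  exact: (bounded_set_frame (cavg_nonempty (Q m) f) hM).
pose t i m x : R := sabs (dot (e m i) (g x)) * \1_(Q m) x.
have t0 i m x : 0 <= t i m x by rewrite mulr_ge0 ?sabs_ge0// indicE.
have mt i m : measurable_fun setT (t i m).
  exact: (measurable_funM (measurable_sabs_dot (L0_cst (e m i)) mg) (measurable_indic (mQ m))).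
pose D : R := CT * 3 ^+ n.
have D0 : 0 <= D by rewrite mulr_ge0 ?exprn_ge0.
pose b x m : R := D * \sum_i t i m x.
have b0 x m : 0 <= b x m by rewrite mulr_ge0// sumr_ge0.
have mb m : measurable_fun setT (fun x => (b x m)%:E).
  apply/measurable_EFinP; apply: (measurable_funM (measurable_cst D)).
  by apply: measurable_sum => i; exact: mt.
have hb : {ae mu, forall x, setT x ->
    ((sabs (dot (g x) (h x)))%:E <= \sum_(m <oo) (b x m)%:E)%E}.
  apply: filterS hdom => x [u Su ->] _.
  (* The factor CT is moved to the tested vector, where the closed sum does not
     see it. *)
  pose a := sC k CT 0 *: g x.
  have aE w : sabs (dot a w) = CT * sabs (dot (g x) w).
    by rewrite dotZl sabsM sabs_sC ger0_norm.
  have -> : sabs (dot (g x) (rscale CT u)) = sabs (dot a u).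
    by rewrite aE sabs_dotZr sabs_sC ger0_norm.
  apply: (setsum_sabs_dot iotaI (b0 x) _ Su) => P w SP.
  rewrite /Krestrict; case: asboolP => [Px|_ ->]; last by rewrite dot0r sabs0.
  rewrite -{1}(iotaK _ SP) => /(proj2 (he (iota P)))[c [c3 ->]].
  rewrite aE /b /D -mulrA ler_wpM2l// mulr_sumr dot_sumr.
  apply: (le_trans (sabs_sum _ _ _)); apply: ler_sum => i _.
  rewrite /t iotaK// indicE mem_set// mulr1 sabs_dotZr sabs_dotC.
  by rewrite ler_wpM2r ?sabs_ge0.
have mphi : measurable_fun setT (fun x => \sum_(m <oo) (b x m)%:E)%E.
  by apply: ge0_emeasurable_sum => // m x _ _; rewrite lee_fin.
apply: (@le_trans _ _ (\int[mu]_x (\sum_(m <oo) (b x m)%:E))%E).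
  apply: (ae_ge0_le_integral measurableT _ (measurable_sabs_dotE mg mh) _ mphi hb).
  - by move=> x _; rewrite lee_fin sabs_ge0.
  - by move=> x _; apply: nneseries_ge0 => m _ _; rewrite lee_fin.
rewrite (integral_nneseries mu measurableT mb); last by move=> m x _; rewrite lee_fin.
pose K : R := 4 * (C * fnorm X f) * (C' * fnorm (kothe_dual X) g).
have bE m : (\int[mu]_x (b x m)%:E = \sum_i D%:E *
    \int[mu]_(x in Q m) (sabs (dot (e m i) (g x)))%:E)%E.
  rewrite (ge0_integral_lincomb mu D0 (fun i => mt i m) (fun i => t0 i m)).
  by apply: eq_bigr => i _; rewrite integral_mul_indic.
have i0 i m : (0 <= \int[mu]_(x in Q m) (sabs (dot (e m i) (g x)))%:E)%E.
  by apply: integral_ge0 => x _; rewrite lee_fin sabs_ge0.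
rewrite (eq_eseriesr (fun m _ => bE m)) nneseries_sum; last first.
  by move=> i m _; rewrite mule_ge0// lee_fin.
apply: (@le_trans _ _ (\sum_(i < n) (D * K)%:E)%E); last first.
  rewrite sumEFin lee_fin sumr_const card_ord -mulr_natr /D /K.
  by rewrite le_eqVlt; apply/orP; left; apply/eqP; ring.
apply: lee_sum => i _; rewrite nneseriesZl// (EFinM D K) lee_wpmul2l ?lee_fin//.
by apply: (sparse_form_le HX HC HC' Xf Xg cQ mE tE QE) => m; have [] := he m.
Qed.

End sparse_domination.

(** * The bound on T *)
Theorem corollaryD (R : realType) (n : nat) (n_ge1 : (1 <= n)%N) :
  exists2 Cn : R, 0 < Cn &
  forall (k : scalar_field) (d : nat) (d_ge1 : (1 <= d)%N)
    (T : (Rd R d -> 'rV[scalarF R k]_n) -> (Rd R d -> 'rV[scalarF R k]_n))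
    (CT : R) (X : fspace R k d n),
    operator T -> 0 < CT -> sparse_dominated T CT ->
    dirBFS X -> kothe_reflexive X ->
    MK_bounded X -> MK_bounded (kothe_dual X) ->
    forall f, Linfc f -> elt X f ->
      elt X (T f) /\
      fnorm X (T f) <=
        Cn * CT * MK_opnorm X * MK_opnorm (kothe_dual X) * fnorm X f.
Proof.
exists (n%:R * 3 ^+ n * 4); first by rewrite !mulr_gt0 ?exprn_gt0 ?ltr0n.
move=> k d _ T CT X [TL0 _] CT0 Tdom HX [XX nX] MX MX' f Lf Xf.
have HC := MK_bound_opnorm (dirBFS_ge0 HX) MX.
have HC' := MK_bound_opnorm (fun g _ => fnorm_kothe_dual_ge0 X g) MX'.
have [S spS hdom] := Tdom f Lf; have mTf := TL0 _ Lf.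
set B := leRHS.
have B0 : 0 <= B.
  have [C0 _ _] := HC; have [C'0 _ _] := HC'.
  by rewrite !mulr_ge0 ?exprn_ge0 ?(dirBFS_ge0 HX)// ltW.
have normle : (kothe_norm (kothe_dual X) (T f) <= B%:E)%E.
  apply: ub_ereal_sup => _ [g [Xg g1] <-].
  apply: (le_trans (sparse_pairing_le HX HC HC' spS (ltW CT0) Xf Xg mTf hdom)).
  by rewrite g1 mulr1.
have Tf'' : elt (kothe_dual (kothe_dual X)) (T f).
  by split => //; apply: le_lt_trans normle _; exact: ltry.
have XTf : elt X (T f) by rewrite -XX.
split => //; rewrite -(nX _ XTf) /=.
apply: (@fine_le_Ny_or_ge0 R _ B%:E) => //; [exact: ltry|exact: kothe_norm_Ny_or_ge0|].
by right; rewrite lee_fin.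
Qed.
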